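(* Let $\Omega\subset\mathbb{R}^n$ be a bounded Lipschitz domain, let $L$ be a Tonelli Lagrangian, let $g:\partial\Omega\to\mathbb{R}$ satisfy $g(x)-g(y)\leq\Phi^{\Omega}_L(y,x)$ for all $x,y\in\partial\Omega$, and assume $c_{\Omega}(L)\leq0$. Let $u(x)=\inf_{y\in\partial\Omega}\{g(y)+\Phi^{\Omega}_L(y,x)\}$, $x\in\overline{\Omega}$. Then $u$ is dominated by $L$, i.e., $$u(x')-u(x)\leq\Phi^{\Omega}_L(x,x'),\quad\forall x,x'\in\overline\Omega.$$ Moreover, $u$ is Lipschitz on $\overline\Omega$ and $u=g$ on $\partial\Omega$.
   Context: A Tonelli Lagrangian is a $C^2$ function $L:\mathbb{R}^n\times\mathbb{R}^n\to\mathbb{R}$ such that $\frac{\partial^2L}{\partial v^2}(x,v)$ is positive definite for all $(x,v)$, and there exist nondecreasing superlinear functions $\theta_1,\theta_2:[0,+\infty)\to[0,+\infty)$ (superlinear means $\theta(r)/r\to+\infty$ as $r\to+\infty$) and $c_0>0$ with $\theta_2(|v|)\geq L(x,v)\geq\theta_1(|v|)-c_0$ for all $(x,v)$. A Lipschitz domain is a domain whose boundary is locally the graph of a Lipschitz function. For $x,y\in\overline{\Omega}$ and $s<t$, $\Gamma^{s,t}_{x,y}(\overline{\Omega})$ is the set of $\xi\in W^{1,1}([s,t];\mathbb{R}^n)$ with $\xi(\tau)\in\overline\Omega$ for all $\tau\in[s,t]$, $\xi(s)=x$, $\xi(t)=y$. For $t>0$, $$A^{\Omega}_t(x,y)=\inf_{\xi\in\Gamma^{0,t}_{x,y}(\overline{\Omega})}\int_0^tL(\xi,\dot\xi)\,ds,\quad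 \Phi^{\Omega}_L(x,y)=\inf_{t>0}A^{\Omega}_t(x,y),\quad c_{\Omega}(L)=-\inf_{t>0,\,x\in\overline{\Omega}}\tfrac1tA^{\Omega}_t(x,x).$$ *)

(* Defs.v *)
From HB Require Import structures.
From mathcomp Require Import all_boot all_order all_algebra.
From mathcomp Require Import all_classical all_reals all_analysis.

Set Implicit Arguments.
Unset Strict Implicit.
Unset Printing Implicit Defensive.

Import Order.TTheory GRing.Theory Num.Theory.
Import numFieldNormedType.Exports.

Local Open Scope classical_set_scope.
Local Open Scope ring_scope.

Section Calculus.
Variable R : realType.

(* The differential at p is continuous in p: in finite dimension, pointwise
   continuity in every direction w is continuity in operator norm. *)
Definition C1 (V : normedModType R) (f : V -> R) : Prop :=
  (forall p, differentiable f p) /\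
  (forall w : V, continuous (fun p => 'd f p w)).

Definition C2 (V : normedModType R) (f : V -> R) : Prop :=
  C1 f /\ (forall w : V, C1 (fun p => 'd f p w)).

(* `|v| on 'rV_n is the sup norm of the library; this is the Euclidean one. *)
Definition enorm n (v : 'rV[R]_n) : R := Num.sqrt (\sum_(i < n) v 0 i ^+ 2).

Definition hessian n (f : 'rV[R]_n -> R) (v : 'rV[R]_n) : 'M[R]_n :=
  \matrix_(i, j) 'D_(delta_mx 0 i) ('D_(delta_mx 0 j) f) v.

Definition posdef n (M : 'M[R]_n) : Prop :=
  forall w : 'rV[R]_n, w != 0 -> 0 < (w *m M *m w^T) 0 0.

End Calculus.

Section Tonelli.
Variable R : realType.

(* nondecreasing superlinear functions [0, +oo[ -> [0, +oo[; values of theta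
   at negative arguments are irrelevant *)
Definition superlinear (theta : R -> R) : Prop :=
  [/\ forall r, 0 <= r -> 0 <= theta r,
      forall r r', 0 <= r -> r <= r' -> theta r <= theta r' &
      theta r / r @[r --> +oo] --> +oo].

Definition tonelli n (L : 'rV[R]_n -> 'rV[R]_n -> R) : Prop :=
  [/\ C2 (fun p : 'rV[R]_n * 'rV[R]_n => L p.1 p.2),
      forall x v, posdef (hessian (L x) v) &
      exists theta1 theta2 : R -> R, exists c0 : R,
        [/\ superlinear theta1, superlinear theta2, 0 < c0 &
            forall x v, theta1 (enorm v) - c0 <= L x v <= theta2 (enorm v)]].

End Tonelli.

Section Domains.
Variable R : realType.

Definition boundary n (Omega : set 'rV[R]_n) : set 'rV[R]_n :=
  closure Omega `\` interior Omega.

Definition domain n (Omega : set 'rV[R]_n) : Prop :=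
  [/\ open Omega, connected Omega & Omega !=set0].

(* Near each boundary point p, in suitable orthonormal coordinates y *m Q, the
   boundary is the graph of a Lipschitz function gamma giving one coordinate
   in terms of the n others. *)
Definition lipschitz_domain n (Omega : set 'rV[R]_n.+1) : Prop :=
  domain Omega /\
  forall p, boundary Omega p ->
    exists (Q : 'M[R]_n.+1) (gamma : 'rV[R]_n -> R),
      [/\ Q *m Q^T = 1%:M, lipschitz gamma &
          \forall y \near p, boundary Omega y <->
            (y *m Q) 0 ord_max = gamma (col' ord_max (y *m Q))].

End Domains.

Section Curves.
Variables (R : realType) (n : nat).
Implicit Types (s t : R) (xi v : R -> 'rV[R]_n).
Let mu := @lebesgue_measure R.

(* phi \in C^1_c(]s, t[) *)
Definition test_function s t (phi : R -> R) : Prop :=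
  [/\ C1 (phi : R^o -> R),
      compact (closure [set x | phi x != 0]) &
      closure [set x | phi x != 0] `<=` `]s, t[].

Definition L1 s t v : Prop :=
  forall i, mu.-integrable `[s, t] (fun tau => (v tau 0 i)%:E).

Definition weak_derivative s t xi v : Prop :=
  L1 s t v /\
  forall phi, test_function s t phi -> forall i,
    \int[mu]_(tau in `[s, t]) (xi tau 0 i * derive1 phi tau) =
    - \int[mu]_(tau in `[s, t]) (v tau 0 i * phi tau).

(* An element of W^{1,1} of the interval [s, t] is identified with its
   continuous representative, so that its pointwise values are meaningful.
   A curve is a total function, considered only on [s, t]. *)
Definition sobolev11 s t xi : Prop :=
  [/\ {within `[s, t], continuous xi}, L1 s t xi &
      exists v, weak_derivative s t xi v].

Definition curves (Omega : set 'rV[R]_n) s t (x y : 'rV[R]_n) :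
    set (R -> 'rV[R]_n) :=
  [set xi | [/\ sobolev11 s t xi,
                forall tau, tau \in `[s, t] -> closure Omega (xi tau),
                xi s = x & xi t = y]].

End Curves.

Section Action.
Variables (R : realType) (n : nat).
Variables (L : 'rV[R]_n -> 'rV[R]_n -> R) (Omega : set 'rV[R]_n).
Let mu := @lebesgue_measure R.
Local Open Scope ereal_scope.

(* The weak derivative v of xi is unique almost everywhere, so the integral
   depends only on xi. *)
Definition action (t : R) (x y : 'rV[R]_n) : \bar R :=
  ereal_inf [set a | exists xi v : R -> 'rV[R]_n,
    [/\ curves Omega 0 t x y xi, weak_derivative 0 t xi v &
        a = \int[mu]_(tau in `[0%R, t]) (L (xi tau) (v tau))%:E]].

Definition potential (x y : 'rV[R]_n) : \bar R :=
  ereal_inf [set action t x y | t in [set t : R | (0 < t)%R]].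

Definition critical_value : \bar R :=
  - ereal_inf [set a | exists (t : R) (x : 'rV[R]_n),
      [/\ (0 < t)%R, closure Omega x & a = (t^-1)%:E * action t x x]].

Definition boundary_solution (g : 'rV[R]_n -> R) (x : 'rV[R]_n) : \bar R :=
  ereal_inf [set (g y)%:E + potential y x | y in boundary Omega].

End Action.

(* Main.v *)
(** The potential [P] obeys the triangle inequality because admissible curves
    can be concatenated: testing a weak derivative against [phi] times a cutoff
    and letting the cutoff tend to 1 gives an integration by parts formula with
    boundary terms, which cancel at the junction of two curves.
    A segment contained in the closure of the domain, run at speed at most 1,
    gives [P x y <= M |y - x|].  Near a boundary point two points of the closure
    are joined by at most three such segments (climb above the Lipschitz graph,
    cross, descend), so [P] is locally bounded by a multiple of the distance;
    connectedness makes [P] bounded above and compactness makes the bound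
    [P x y <= C |y - x|] global.  Loops have nonnegative action because the
    critical value is nonpositive, so [P] is also finite from below, and the
    three assertions on [u] follow from the triangle inequality. *)

Require Import Defs.
From HB Require Import structures.
From mathcomp Require Import all_boot all_order all_algebra.
From mathcomp Require Import all_classical all_reals all_analysis.
From mathcomp Require Import measurable_realfun ring lra.

Import Order.TTheory GRing.Theory Num.Theory.
Import numFieldNormedType.Exports.

Local Open Scope classical_set_scope.
Local Open Scope ring_scope.

(** * Lebesgue integrals on intervals *)

(** The calculus stays at the level of weak derivatives: a curve is never written as the integral of
    its velocity, and continuity up to the end points is what gives the boundary terms a meaning.
    The geometry concerns an arbitrary [P] that is [triangular] and [segment_bounded]; of the
    Lagrangian it sees only the bound [M] on velocities of norm at most 1. Until loops are taken
    into account, [P] may be infinite of either sign, so it is controlled only through upper bounds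
    by real numbers. The domain hypothesis says that the boundary is locally a graph, not that the
    domain lies on one side of it. The domain may occupy the upper side, the lower side or both, and
    the local estimate has to cope with all three situations. *)

Lemma lebesgue_measure_shift (R : realType) (a : R) (A : set R) :
  measurable A ->
  pushforward (@lebesgue_measure R)
    (center a : measurableTypeR R -> measurableTypeR R) A = lebesgue_measure A.
Proof.
move=> mA.
have mc : measurable_fun setT (center a : measurableTypeR R -> measurableTypeR R).
  by apply: measurable_funB.
pose phi : {mfun measurableTypeR R >-> measurableTypeR R} :=
  HB.pack (center a : measurableTypeR R -> measurableTypeR R)
    (isMeasurableFun.Build _ _ _ _ _ mc).
(* The pushforward is a measure giving each half-open interval its length, and these values
   determine Lebesgue measure. *)
apply/esym; apply: (@lebesgue_measure_unique _
  (pushforward (@lebesgue_measure R) phi)) => // _ [[b c]] _ <-.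
change (lebesgue_measure `]b, c]%classic =
  @lebesgue_measure R (center a @^-1` `]b, c])).
have -> : center a @^-1` `]b, c] = `]b + a, c + a]%classic.
  by apply/seteqP; split=> x /=; rewrite !in_itv/= ltrBrDr lerBlDr.
rewrite !lebesgue_measure_itv/= !lte_fin ltrD2r -!EFinB.
by have -> : c + a - (b + a) = c - b by ring.
Qed.

Lemma center_itv (R : realType) (a s t : R) :
  center a @^-1` `[s, t] = `[s + a, t + a]%classic.
Proof. by apply/seteqP; split=> x /=; rewrite !in_itv/= lerBrDr lerBlDr. Qed.

Lemma measurable_center [R : realType] (a : R) :
  measurable_fun setT (center a : measurableTypeR R -> measurableTypeR R).
Proof. exact: measurable_funB. Qed.

Lemma measurable_fun_shift [R : realType] (a s t : R) (f : R -> \bar R) :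
  measurable_fun `[s, t] f -> measurable_fun `[s + a, t + a] (f \o center a).
Proof.
move=> mf; apply: (measurable_comp (F := `[s, t]%classic)) => //.
  by rewrite -center_itv; apply: image_preimage_subset.
by apply: measurable_funTS; exact: measurable_center.
Qed.

(** Only measurability is assumed, since the action of a curve may be infinite; the change of
    variable for nonnegative functions is applied to the positive and negative parts. *)
Lemma integral_shift [R : realType] (a s t : R) (f : R -> \bar R) :
  measurable_fun `[s, t] f ->
  (\int[lebesgue_measure]_(x in `[(s + a)%R, (t + a)%R]) f (center a x) =
   \int[lebesgue_measure]_(x in `[s, t]) f x)%E.
Proof.
have ge0_shift (h : R -> \bar R) : measurable_fun `[s, t] h ->
    (forall x, 0 <= h x)%E ->
    (\int[lebesgue_measure]_(x in `[(s + a)%R, (t + a)%R]) h (center a x) =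
     \int[lebesgue_measure]_(x in `[s, t]) h x)%E.
  move=> mh h0; rewrite -center_itv.
  have := @ge0_integral_pushforward _ _ _ _ _ _ (measurable_center a)
    (@lebesgue_measure R) `[s, t]%classic h.
  move=> <-//.
  apply: eq_measure_integral => [|mc A mA _]; first exact: measurable_center.
  exact: lebesgue_measure_shift.
move=> mf; rewrite integralE [RHS]integralE; congr (_ - _)%E.
  rewrite -(ge0_shift _ (measurable_funepos mf) (funepos_ge0 f)).
  by apply: eq_integral => x _; rewrite !funeposE.
rewrite -(ge0_shift _ (measurable_funeneg mf) (funeneg_ge0 f)).
by apply: eq_integral => x _; rewrite !funenegE.
Qed.

(** A quadratic error bound treats the knots of a spline and its other points alike. *)
Lemma is_derive_quadratic (R : realType) (f : R -> R) (x d K : R) :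
  (forall h, `|f (x + h) - f x - h * d| <= K * h ^+ 2) ->
  is_derive x (1 : R) f d.
Proof.
move=> fd.
have K0 : `|h| * K @[h --> (0 : R)^'] --> (0 : R).
  have N0 : `|h| @[h --> (0 : R)^'] --> (0 : R).
    apply: cvg_within_filter.
    by have := @norm_continuous _ R^o (0 : R); rewrite /continuous_at normr0.
  have := @cvgMr_tmp R _ _ _ _ _ K N0; rewrite mul0r. exact.
have fc : h^-1 *: (f (h *: (1 : R) + x) - f x) @[h --> 0^'] --> d.
  apply: cvg_zero.
  apply: (@squeeze_cvgr _ _ _ _ (fun h => - (`|h| * K)) (fun h => `|h| * K)).
  - near=> h.
    have h0 : h != 0 by near: h; exact: nbhs_dnbhs_neq.
    rewrite -ler_norml.
    change (`|h^-1 *: (f (h *: (1 : R) + x) - f x) - d| <= `|h| * K).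
    have -> : h^-1 *: (f (h *: (1 : R) + x) - f x) - d
        = h^-1 * (f (x + h) - f x - h * d).
      by rewrite /GRing.scale/= mulr1 (addrC h); field.
    rewrite normrM normfV ler_pdivrMl ?normr_gt0//.
    by apply: le_trans (fd h) _; rewrite -real_normK ?num_real// expr2 mulrC mulrA.
  - by rewrite -[X in _ --> X]oppr0; exact: cvgN.
  - exact: K0.
apply: DeriveDef; last exact/cvg_lim.
by apply/cvg_ex; exists d.
Unshelve. all: by end_near. Qed.

(* A C^1 quadratic spline rising from 0 to 1 on [0, 2]. *)
Definition step {R : realType} (x : R) : R :=
  (Num.max x 0 ^+ 2 - 2 * Num.max (x - 1) 0 ^+ 2 + Num.max (x - 2) 0 ^+ 2) / 2.
(** The derivative of [step]: a tent supported on [0, 2] with peak 1 at 1 and mass 1. *)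
Definition hat {R : realType} (x : R) : R :=
  Num.max x 0 - 2 * Num.max (x - 1) 0 + Num.max (x - 2) 0.

Lemma is_derive_step (R : realType) (x : R) : is_derive x (1 : R) (@step R) (hat x).
Proof.
(* Each squared positive part has error at most [h ^+ 2]; the weights 1, 2, 1 and the division by 2
   add up to 2. *)
apply: (@is_derive_quadratic _ _ _ _ 2) => h; rewrite /step /hat.
have P (y z : R) : z = y + h ->
    `|Num.max z 0 ^+ 2 - Num.max y 0 ^+ 2 - h * (2 * Num.max y 0)|
    <= h ^+ 2.
  move=> ->; rewrite ler_norml.
  by case: (leP y 0) => x0; case: (leP (y + h) 0) => xh0; apply/andP; split; nra.
have P0 := P x (x + h) erefl.
have P1 : _ <= _ := P (x - 1) (x + h - 1) ltac:(ring).
have P2 : _ <= _ := P (x - 2) (x + h - 2) ltac:(ring).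
move: P0 P1 P2.
rewrite !ler_norml => /andP[? ?] /andP[? ?] /andP[? ?]; apply/andP; split; lra.
Qed.

Lemma hat_ge0 (R : realType) (x : R) : 0 <= hat x.
Proof.
rewrite /hat; case: (leP x 0) => ?; case: (leP (x - 1) 0) => ?;
  case: (leP (x - 2) 0) => ?; lra.
Qed.

Lemma hat_eq0 (R : realType) (x : R) : x <= 0 \/ 2 <= x -> hat x = 0.
Proof.
rewrite /hat; case: (leP x 0) => ?; case: (leP (x - 1) 0) => ?;
  case: (leP (x - 2) 0) => ?; case; lra.
Qed.

Lemma step_eq0 (R : realType) (x : R) : x <= 0 -> step x = 0.
Proof.
rewrite /step; case: (leP x 0) => ?; case: (leP (x - 1) 0) => ?;
  case: (leP (x - 2) 0) => ?; nra.
Qed.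

Lemma step_eq1 (R : realType) (x : R) : 2 <= x -> step x = 1.
Proof.
rewrite /step; case: (leP x 0) => ?; case: (leP (x - 1) 0) => ?;
  case: (leP (x - 2) 0) => ?; nra.
Qed.

Lemma step_itv [R : realType] (x : R) : 0 <= step x <= 1.
Proof.
rewrite /step; case: (leP x 0) => ?; case: (leP (x - 1) 0) => ?;
  case: (leP (x - 2) 0) => ?; apply/andP; split; nra.
Qed.

Lemma continuous_hat (R : realType) : continuous (@hat R).
Proof.
have M : continuous (fun x : R => Num.max x 0).
  by move=> x; apply: (@continuous_max _ _ id (cst 0)); [exact: cvg_id|exact: cvg_cst].
have MB (c : R) : continuous (fun x : R => Num.max (x - c) 0).
  move=> x; apply: (@continuous_comp _ _ _ (fun x => x - c) (fun y => Num.max y 0)).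
    by apply: cvgB; [exact: cvg_id|exact: cvg_cst].
  exact: M.
move=> x; apply: cvgD; last exact: MB.
by apply: cvgB; [exact: M|apply: cvgM; [exact: cvg_cst|exact: MB]].
Qed.

Lemma C1P (R : realType) (f : R -> R) :
  C1 (f : R^o -> R) <->
  (forall x, derivable f x (1 : R)) /\ continuous (f^`())%classic.
Proof.
split=> [[df cf]|[df cf]]; split.
- by move=> x; apply/derivable1_diffP; exact: df.
- have -> : (f^`())%classic = (fun p => 'd (f : R^o -> R) p 1).
    by apply/funext => x; rewrite derive1E deriveE//; exact: df.
  exact: cf.
- by move=> x; apply/derivable1_diffP; exact: df.
- move=> w.
  have -> : (fun p => 'd (f : R^o -> R) p w) = (fun p => w * (f^`())%classic p).
    by apply/funext => x; rewrite diff1E//; exact/derivable1_diffP.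
  by move=> x; apply: cvgM; [exact: cvg_cst|exact: cf].
Qed.

Lemma within_integrable [R : realType] [s t : R] [f : R -> R] :
  {within `[s, t], continuous f} ->
  (@lebesgue_measure R).-integrable `[s, t] (EFin \o f).
Proof. by move=> cf; apply: continuous_compact_integrable => //; exact: segment_compact. Qed.

Lemma within_bounded [R : realType] [s t : R] [f : R -> R] :
  {within `[s, t], continuous f} -> exists M, forall x, x \in `[s, t] -> `|f x| <= M.
Proof.
move=> cf; have /compact_bounded[M [_ HM]] :=
  continuous_compact cf (@segment_compact _ s t).
exists (M + 1) => x xst; apply: (HM (M + 1)); first by rewrite ltrDl.
by exists x.
Qed.

Lemma within_measurable (R : realType) (s t : R) (f : R -> R) :
  {within `[s, t], continuous f} -> measurable_fun `[s, t] f.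
Proof. by move=> cf; apply: subspace_continuous_measurable_fun. Qed.

Lemma integrable_mulr_within [R : realType] [s t : R] [f h : R -> R] :
  (@lebesgue_measure R).-integrable `[s, t] (EFin \o f) ->
  {within `[s, t], continuous h} ->
  (@lebesgue_measure R).-integrable `[s, t] (EFin \o (fun x => f x * h x)).
Proof.
move=> fi ch; have [M HM] := within_bounded ch.
have -> : EFin \o (fun x => f x * h x) = ((EFin \o f) \* (EFin \o h))%E.
  by apply/funext => x /=; rewrite EFinM.
apply: integrableMl => //; first exact: within_measurable.
by exists M; split; [exact: num_real|move=> K MK x /= xst; apply: le_trans (ltW MK); exact: HM].
Qed.

Lemma integrable_EFinB (d : measure_display) (T : measurableType d) (R : realType)
    (mu : {measure set T -> \bar R}) (D : set T) (f h : T -> R) : measurable D ->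
  mu.-integrable D (EFin \o f) -> mu.-integrable D (EFin \o h) ->
  mu.-integrable D (EFin \o (fun x => f x - h x)).
Proof.
move=> mD fi hi; have := integrableB mD fi hi; apply: eq_integrable => // x _.
Qed.

Lemma within_continuousT [R : realType] [s t : R] [f : R -> R] :
  continuous f -> {within `[s, t], continuous f}.
Proof. by move=> cf; apply: continuous_subspaceT. Qed.

Lemma Rintegral_derive [R : realType] [s t : R] [F f : R -> R] : s < t ->
  (forall x, is_derive x (1 : R) F (f x)) -> continuous f ->
  \int[lebesgue_measure]_(x in `[s, t]) f x = F t - F s.
Proof.
move=> st dF cf.
have cF x : {for x, continuous F}.
  apply: differentiable_continuous; apply/derivable1_diffP.
  exact: (@ex_derive _ _ _ _ _ _ _ (dF x)).
rewrite /Rintegral (@continuous_FTC2 _ f F)//.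
- exact: within_continuousT.
- split; last 2 first.
    by apply: cvg_at_right_filter; exact: cF.
  by apply: cvg_at_left_filter; exact: cF.
  by move=> x _; exact: (@ex_derive _ _ _ _ _ _ _ (dF x)).
- by move=> x _; rewrite derive1E (@derive_val _ _ _ _ _ _ _ (dF x)).
Qed.

(** The mass of [rho n] is counted inside [[s, t]] only, so [c] may be an end point and still
    receive the full value [f c]. *)
Lemma approximate_identity [R : realType] (s t c : R) (f : R -> R)
    (rho : nat -> R -> R) : s < t -> c \in `[s, t] ->
  {within `[s, t], continuous f} ->
  (forall n, continuous (rho n)) -> (forall n x, 0 <= rho n x) ->
  (forall n, \int[lebesgue_measure]_(x in `[s, t]) rho n x = 1) ->
  (forall d, 0 < d -> \forall n \near \oo, forall x, d <= `|x - c| ->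
     x \in `[s, t] -> rho n x = 0) ->
  \int[lebesgue_measure]_(x in `[s, t]) (f x * rho n x) @[n --> \oo] --> f c.
Proof.
move=> st cst cf crho rho0 irho crho0.
apply/cvgrPdist_le => e e0.
have /cvgrPdist_le/(_ _ e0) : f x @[x --> within `[s, t] (nbhs c)] --> f c.
  by move/subspace_continuousP : cf; apply.
move=> [d/= d0 Hd].
have {crho0} := crho0 _ d0; apply: filterS => n rhon.
have irn : (@lebesgue_measure R).-integrable `[s, t] (EFin \o rho n).
  by apply: within_integrable; exact: within_continuousT.
have ifr : (@lebesgue_measure R).-integrable `[s, t] (EFin \o (fun x => f x * rho n x)).
  apply: integrable_mulr_within; first exact: within_integrable.
  exact: within_continuousT.
have icr r : (@lebesgue_measure R).-integrable `[s, t] (EFin \o (fun x => r * rho n x)).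
  apply: within_integrable; apply: within_continuousT => x.
  by apply: cvgM; [exact: cvg_cst|exact: crho].
(* Mass 1 turns [f c], and below also [e], into integrals against [rho n], which are then compared
   pointwise. *)
rewrite -[f c]mulr1 -(irho n) -RintegralZl// -RintegralB//.
apply: le_trans (le_normr_Rintegral _ _) _ => //.
  exact: integrable_EFinB.
rewrite -[e]mulr1 -(irho n) -RintegralZl//; apply: le_Rintegral => //.
  apply: integrable_norm.
  exact: integrable_EFinB.
move=> x xst; rewrite -mulrBl normrM (ger0_norm (rho0 _ _)).
have [dx|dx] := leP d `|x - c|.
  by rewrite rhon// !mulr0.
by apply: ler_wpM2r => //; apply: (Hd x) => //=; rewrite distrC.
Qed.

(** Dominated convergence on the open interval: the cutoffs vanish at the end points, so convergence
    to 1 can only be asked strictly inside. *)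
Lemma Rintegral_cvg_bounded [R : realType] [s t : R] [f : R -> R]
    [chi : nat -> R -> R] : s < t ->
  (@lebesgue_measure R).-integrable `[s, t] (EFin \o f) ->
  (forall n, continuous (chi n)) -> (forall n x, `|chi n x| <= 1) ->
  (forall x, s < x < t -> chi n x @[n --> \oo] --> (1 : R)) ->
  \int[lebesgue_measure]_(x in `[s, t]) (f x * chi n x) @[n --> \oo] -->
  \int[lebesgue_measure]_(x in `[s, t]) f x.
Proof.
move=> st fi cchi chi1 chicvg.
have fi' : (@lebesgue_measure R).-integrable `]s, t[ (EFin \o f).
  by apply: integrableS fi => //; apply: subset_itv; rewrite bnd_simp.
have ifc n : (@lebesgue_measure R).-integrable `]s, t[ (EFin \o (fun x => f x * chi n x)).
  have /integrableS : (@lebesgue_measure R).-integrable `[s, t]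
      (EFin \o (fun x => f x * chi n x)).
    by apply: integrable_mulr_within => //; exact: within_continuousT.
  by apply => //; apply: subset_itv; rewrite bnd_simp.
have E (g : R -> R) : (@lebesgue_measure R).-integrable `]s, t[ (EFin \o g) ->
    (\int[lebesgue_measure]_(x in `[s, t]) g x)%:E =
    (\int[lebesgue_measure]_(x in `]s, t[) (g x)%:E)%E.
  move=> ig; rewrite /Rintegral (integral_itv_bndoo true false); last exact: measurable_int ig.
  by rewrite fineK//; exact: (integrable_fin_num _ ig).
suff : (fun n => (\int[lebesgue_measure]_(x in `[s, t]) (f x * chi n x))%:E)
    @ \oo --> (\int[lebesgue_measure]_(x in `[s, t]) f x)%:E.
  by move/fine_cvgP => [_].
rewrite E//; under eq_fun do rewrite E//.
apply: (@dominated_cvg _ (measurableTypeR R) R (@lebesgue_measure R) `]s, t[%classic _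
  (fun n x => (f x * chi n x)%:E) (fun x => (f x)%:E) (fun x => `|(f x)%:E|%E)) => //.
- by move=> n; exact: measurable_int (ifc n).
- move=> x; rewrite /= in_itv/= => xst.
  apply: cvg_EFin; first exact: nearW.
  by rewrite -[X in _ --> X]mulr1; apply: cvgM; [exact: cvg_cst|exact: chicvg].
- exact: integrable_abse.
- move=> n x _ /=; rewrite lee_fin normrM -[leRHS]mulr1.
  by apply: ler_wpM2l.
Qed.

(** * Integration by parts for weak derivatives *)

Lemma is_derive_affine [R : realType] (m e x : R) :
  is_derive x (1 : R) (fun y => m * y + e) m.
Proof.
apply: (@is_derive_quadratic _ _ _ _ 0) => h.
by rewrite mul0r (_ : _ - _ = 0) ?normr0//; ring.
Qed.

Lemma continuous_affine [R : realType] (m e : R) : continuous (fun y : R => m * y + e).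
Proof.
move=> x; apply: cvgD; last exact: cvg_cst.
by apply: cvgM; [exact: cvg_cst|exact: cvg_id].
Qed.

Lemma is_derive_ramp [R : realType] (m e x : R) :
  is_derive x (1 : R) (fun y => step (m * y + e)) (m * hat (m * x + e)).
Proof.
rewrite mulrC; apply: (@is_derive1_comp _ (@step R) (fun y => m * y + e)).
  exact: is_derive_step.
exact: is_derive_affine.
Qed.

Lemma continuous_dramp (R : realType) (m e : R) :
  continuous (fun x => m * hat (m * x + e)).
Proof.
move=> x; apply: cvgM; first exact: cvg_cst.
apply: (@continuous_comp _ _ _ (fun y => m * y + e) (hat)).
  exact: continuous_affine.
exact: continuous_hat.
Qed.

Lemma is_derive_continuous (R : realType) (f : R -> R) (x d : R) :
  is_derive x (1 : R) f d -> {for x, continuous f}.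
Proof.
move=> df; apply: differentiable_continuous; apply/derivable1_diffP.
exact: (@ex_derive _ _ _ _ _ _ _ df).
Qed.

(* The test functions of the weak derivative vanish near the end points; the
   cutoffs [chi n] localize an arbitrary C^1 function, and their derivatives
   converge to the difference of the Dirac masses at [s] and [t]. *)
Lemma weak_integration_by_parts [R : realType] [s t : R] [x w : R -> R] : s < t ->
  {within `[s, t], continuous x} ->
  (@lebesgue_measure R).-integrable `[s, t] (EFin \o w) ->
  (forall phi, test_function s t phi ->
     \int[lebesgue_measure]_(y in `[s, t]) (x y * derive1 phi y) =
     - \int[lebesgue_measure]_(y in `[s, t]) (w y * phi y)) ->
  forall phi, C1 (phi : R^o -> R) ->
     \int[lebesgue_measure]_(y in `[s, t]) (x y * derive1 phi y) =
     x t * phi t - x s * phi s - \int[lebesgue_measure]_(y in `[s, t]) (w y * phi y).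
Proof.
move=> st cx iw xw phi /[dup] C1phi /C1P[dphi cdphi].
have isdphi y : is_derive y (1 : R) phi (derive1 phi y).
  by apply: DeriveDef => //; rewrite derive1E.
have cphi : continuous phi by move=> y; exact: is_derive_continuous (isdphi y).
(* The ramps of [chi n] will occupy [s + 1/m, s + 3/m] and [t - 3/m, t - 1/m] with m = [m n]. Since
   [m n * (t - s)] is at least 4, the right one does not start before the left one, and the two
   steps agree outside [s + 1/m, t - 1/m]. *)
pose m n : R := 4 * n.+1%:R / (t - s).
have ts0 : 0 < t - s by rewrite subr_gt0.
have mts n : m n * (t - s) = 4 * n.+1%:R.
  by rewrite /m divfK// gt_eqF.
have m4 n : 4 <= m n * (t - s).
  have : (1 : R) <= n.+1%:R by rewrite ler1n.
  by rewrite mts => ?; lra.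
have m0 n : 0 < m n by rewrite /m divr_gt0// mulr_gt0.
have mlarge (M d : R) : 0 < d -> \forall n \near \oo, M <= m n * d.
  move=> d0; have := nbhs_infty_ger (M * (t - s) / d).
  apply: filterS => n; rewrite ler_pdivrMr// => H.
  rewrite /m mulrAC ler_pdivlMr//; apply: le_trans H _.
  apply: ler_wpM2r; first exact: ltW.
  rewrite -natr1; have : 0 <= n%:R :> R by []. 
  lra.
pose el n := - (m n * s) - 1.
pose er n := - (m n * t) + 3.
pose chi n y := step (m n * y + el n) - step (m n * y + er n).
pose dl n y := m n * hat (m n * y + el n).
pose dr n y := m n * hat (m n * y + er n).
have elE n y : m n * y + el n = m n * (y - s) - 1 by rewrite /el; ring.
have erE n y : m n * y + er n = 3 - m n * (t - y) by rewrite /er; ring.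
have dchi n y : is_derive y (1 : R) (chi n) (dl n y - dr n y).
  by apply: is_deriveB; exact: is_derive_ramp.
have cchi n : continuous (chi n).
  by move=> y; exact: is_derive_continuous (dchi n y).
have chi0 n y : chi n y != 0 -> s + (m n)^-1 <= y <= t - (m n)^-1.
  apply: contra_neqT; rewrite negb_and -!ltNge /chi elE erE => /orP[] ym.
    have : m n * (y - s) < 1.
      by rewrite -(mulfV (lt0r_neq0 (m0 n))) ltr_pM2l// ltrBlDl.
    by move=> ?; have m4n := m4 n; rewrite !step_eq0 ?subr0//; lra.
  have : m n * (t - y) < 1.
    by rewrite -(mulfV (lt0r_neq0 (m0 n))) ltr_pM2l// ltrBlDr -ltrBlDl.
  by move=> ?; have m4n := m4 n; rewrite !step_eq1 ?subrr//; lra.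
have dphichi n y : is_derive y (1 : R) (phi \* chi n)
    (phi y * (dl n y - dr n y) + chi n y * derive1 phi y).
  exact: (is_deriveM (isdphi y) (dchi n y)).
have cdl n : continuous (dl n) by exact: continuous_dramp.
have cdr n : continuous (dr n) by exact: continuous_dramp.
have D1 n y : derive1 (phi \* chi n) y =
    phi y * (dl n y - dr n y) + chi n y * derive1 phi y.
  by rewrite derive1E (@derive_val _ _ _ _ _ _ _ (dphichi n y)).
have tphi n : test_function s t (phi \* chi n).
  have sub : closure [set y | (phi \* chi n) y != 0]
      `<=` `[s + (m n)^-1, t - (m n)^-1].
    have /closure_id -> : closed `[s + (m n)^-1, t - (m n)^-1]%classic.
      exact: interval_closed.
    apply: closure_subset => y /=; rewrite mulf_eq0 negb_or => /andP[_ /chi0].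
    by rewrite in_itv.
  split.
  - apply/C1P; split; first by move=> y; exact: (@ex_derive _ _ _ _ _ _ _ (dphichi n y)).
    rewrite (_ : derive1 _ = fun y => phi y * (dl n y - dr n y)
      + chi n y * derive1 phi y); last first.
      by apply/funext => y; exact: D1.
    move=> y; apply: cvgD; apply: cvgM; [exact: cphi| |exact: cchi|exact: cdphi].
    by apply: cvgB; [exact: cdl|exact: cdr].
  - by apply: subclosed_compact sub; [exact: closed_closure|exact: segment_compact].
  - apply: subset_trans sub _ => y /=; rewrite !in_itv/= => /andP[sy yt].
    have : 0 < (m n)^-1 by rewrite invr_gt0.
    by move=> ?; apply/andP; split; lra.
have cxphi : {within `[s, t], continuous (fun y => x y * phi y)}.
  by move=> y; apply: cvgM; [exact: cx|exact: (within_continuousT cphi)].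
have cxdphi : {within `[s, t], continuous (fun y => x y * derive1 phi y)}.
  by move=> y; apply: cvgM; [exact: cx|exact: (within_continuousT cdphi)].
have iwphi := integrable_mulr_within iw (within_continuousT cphi).
have wint (f : R -> R) h : {within `[s, t], continuous f} -> continuous h ->
    (@lebesgue_measure R).-integrable `[s, t] (EFin \o (fun y => f y * h y)).
  move=> cf ch; apply: integrable_mulr_within; first exact: within_integrable.
  exact: within_continuousT.
have Ileft : \int[lebesgue_measure]_(y in `[s, t]) (x y * phi y * dl n y)
    @[n --> \oo] --> x s * phi s.
  apply: (approximate_identity s t s (fun y => x y * phi y)) => //.
  - by rewrite in_itv/= lexx ltW.
  - by move=> n y; rewrite mulr_ge0 ?hat_ge0// ltW.
  - move=> n; rewrite (Rintegral_derive st (is_derive_ramp _ _)); last first.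
      exact: continuous_dramp.
    have m4n := m4 n; rewrite !elE subrr mulr0 step_eq1; last by lra.
    by rewrite step_eq0 ?subr0//; lra.
  - move=> d d0; have := mlarge 3 d d0; apply: filterS => n md y dy.
    rewrite in_itv/= => /andP[sy yt]; rewrite /dl elE hat_eq0 ?mulr0//; right.
    move: dy; rewrite ger0_norm ?subr_ge0// => dy.
    by have := m0 n; nra.
have Iright : \int[lebesgue_measure]_(y in `[s, t]) (x y * phi y * dr n y)
    @[n --> \oo] --> x t * phi t.
  apply: (approximate_identity s t t (fun y => x y * phi y)) => //.
  - by rewrite in_itv/= lexx ltW.
  - by move=> n y; rewrite mulr_ge0 ?hat_ge0// ltW.
  - move=> n; rewrite (Rintegral_derive st (is_derive_ramp _ _)); last first.
      exact: continuous_dramp.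
    have m4n := m4 n; rewrite !erE subrr mulr0 step_eq1; last by lra.
    by rewrite step_eq0 ?subr0//; lra.
  - move=> d d0; have := mlarge 3 d d0; apply: filterS => n md y dy.
    rewrite in_itv/= => /andP[sy yt]; rewrite /dr erE hat_eq0 ?mulr0//; left.
    move: dy; rewrite ler0_norm ?subr_le0// => dy.
    by have := m0 n; nra.
have chile1 n y : `|chi n y| <= 1.
  rewrite /chi ler_norml; have := step_itv (m n * y + el n).
  have := step_itv (m n * y + er n).
  by move=> /andP[? ?] /andP[? ?]; apply/andP; split; lra.
have chicvg y : s < y < t -> chi n y @[n --> \oo] --> (1 : R).
  move=> /andP[sy yt]; apply: cvg_near_cst; near=> n.
  have : 3 <= m n * (y - s) by near: n; apply: mlarge; rewrite subr_gt0.
  have : 3 <= m n * (t - y) by near: n; apply: mlarge; rewrite subr_gt0.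
  move=> ? ?; rewrite /chi elE erE step_eq1 ?step_eq0 ?subr0//; lra.
have Imid := Rintegral_cvg_bounded st
  (within_integrable cxdphi) cchi chile1 chicvg.
have Iw := Rintegral_cvg_bounded st iwphi cchi chile1 chicvg.
(* The weak identity for the test function [phi \* chi n], expanded by the product rule; every term
   has a known limit. *)
have E n : \int[lebesgue_measure]_(y in `[s, t]) (x y * derive1 phi y * chi n y) =
    \int[lebesgue_measure]_(y in `[s, t]) (x y * phi y * dr n y)
    - \int[lebesgue_measure]_(y in `[s, t]) (x y * phi y * dl n y)
    - \int[lebesgue_measure]_(y in `[s, t]) (w y * phi y * chi n y).
  have := xw _ (tphi n).
  have -> : \int[lebesgue_measure]_(y in `[s, t]) (x y * derive1 (phi \* chi n) y) =
      \int[lebesgue_measure]_(y in `[s, t]) (x y * derive1 phi y * chi n y +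
        (x y * phi y * dl n y - x y * phi y * dr n y)).
    by apply: eq_Rintegral => y _; rewrite D1; ring.
  rewrite RintegralD//; [|exact: wint|by apply: integrable_EFinB => //; exact: wint].
  rewrite RintegralB//; [|exact: wint|exact: wint].
  have -> : \int[lebesgue_measure]_(y in `[s, t]) (w y * (phi \* chi n) y) =
      \int[lebesgue_measure]_(y in `[s, t]) (w y * phi y * chi n y).
    by apply: eq_Rintegral => y _ /=; ring.
  by move=> H; lra.
have {}E : (fun n => \int[lebesgue_measure]_(y in `[s, t]) (x y * derive1 phi y * chi n y)) =
    (fun n => \int[lebesgue_measure]_(y in `[s, t]) (x y * phi y * dr n y)
    - \int[lebesgue_measure]_(y in `[s, t]) (x y * phi y * dl n y)
    - \int[lebesgue_measure]_(y in `[s, t]) (w y * phi y * chi n y)).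
  by apply/funext.
rewrite E in Imid.
exact: (cvg_unique (@Rhausdorff R) Imid (cvgB (cvgB Iright Ileft) Iw)).
Unshelve. all: by end_near. Qed.

(** * Concatenation of curves *)

Lemma rV_norm_le [R : realType] [n : nat] [v : 'rV[R]_n] [e : R] : 0 <= e ->
  (forall i, `|v 0 i| <= e) -> `|v| <= e.
Proof.
move=> e0 ve; rewrite /Num.norm/= mx_normrE; apply: bigmax_le => // -[i j] _ /=.
by rewrite (ord1 i).
Qed.

Lemma rV_norm_ge [R : realType] [n : nat] (v : 'rV[R]_n) i : `|v 0 i| <= `|v|.
Proof.
rewrite [leRHS]/Num.norm/= mx_normrE.
by apply: (le_bigmax _ (fun ij => `|v ij.1 ij.2|) (0, i)).
Qed.

(** The velocity is merely measurable, so it is rounded down to the grid of mesh 1/(k+1). The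
    rounded velocity has countably many values, on each of which the integrand is continuous in
    time, and continuity of [L] gives the pointwise limit. *)
Lemma measurable_fun_continuous2 [R : realType] [n : nat] [s t : R]
    [L : 'rV[R]_n -> 'rV[R]_n -> R] [x : R -> 'rV[R]_n] (v : R -> 'rV[R]_n) :
  continuous (fun p : 'rV[R]_n * 'rV[R]_n => L p.1 p.2) ->
  {within `[s, t], continuous x} ->
  (forall i, measurable_fun `[s, t] (fun y => v y 0 i)) ->
  measurable_fun `[s, t] (fun y => L (x y) (v y)).
Proof.
move=> cL cx mv.
pose fl k y : 'rV[int]_n := \row_i Num.floor (k.+1%:R * v y 0 i).
pose q k (z : 'rV[int]_n) : 'rV[R]_n := \row_i ((z 0 i)%:~R / k.+1%:R).
apply: (measurable_fun_cvg (h := fun k y => L (x y) (q k (fl k y)))); last first.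
  move=> y _.
  have qv : q k (fl k y) @[k --> \oo] --> v y.
    apply/cvgrPdist_le => e e0.
    have := nbhs_infty_ger e^-1; apply: filterS => k ke.
    apply: rV_norm_le => [|i]; first exact: ltW.
    have k0 : 0 < k.+1%:R :> R by [].
    have /andP[] := floor_itv (k.+1%:R * v y 0 i).
    rewrite !mxE; set z := Num.floor _ => z1; rewrite intrD => z2.
    have -> : v y 0 i - z%:~R / k.+1%:R = (k.+1%:R * v y 0 i - z%:~R) / k.+1%:R.
      by field; rewrite gt_eqF.
    rewrite ger0_norm ?divr_ge0 ?subr_ge0// ler_pdivrMr//.
    have : e^-1 <= k.+1%:R by apply: le_trans ke _; rewrite ler_nat.
    rewrite -(ler_pM2l e0) mulfV ?gt_eqF// => H.
    by apply: le_trans H; rewrite lerBlDl; exact: ltW.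
  apply: (@cvg_comp _ _ _ (fun k => (x y, q k (fl k y)))
    (fun p : 'rV[R]_n * 'rV[R]_n => L p.1 p.2) _ (nbhs (x y, v y))).
    exact: (cvg_pair (cvg_cst (x y)) qv).
  exact: (cL (x y, v y)).
move=> k.
(* The level sets of the rounded velocity, enumerated by the countable type of integer vectors. *)
pose E i : set R := if unpickle i is Some z then
   [set y | y \in `[s, t] /\ fl k y = z] else set0.
have mE i : measurable (E i).
  rewrite /E; case: (unpickle i) => [z|]; last exact: measurable0.
  have -> : [set y | y \in `[s, t] /\ fl k y = z] = `[s, t]%classic `&`
      \bigcap_(j in [set: 'I_n]) (`[s, t]%classic `&` (fun y => v y 0 j) @^-1`
         `[(z 0 j)%:~R / k.+1%:R, ((z 0 j) + 1)%:~R / k.+1%:R[).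
    apply/seteqP; split => y /=.
      move=> [yst <-]; split=> // j _; split => //=.
      rewrite in_itv/= !mxE ler_pdivrMr// ltr_pdivlMr// mulrC.
      exact: floor_itv.
    move=> [yst H]; split=> //; apply/rowP => j; rewrite !mxE.
    have [_ /=] := H j Logic.I.
    rewrite in_itv/= ler_pdivrMr// ltr_pdivlMr// mulrC => zy.
    exact/floor_def.
  apply: measurableI => //; apply: fin_bigcap_measurable => // j _.
  exact: mv.
have UE : `[s, t]%classic = \bigcup_i E i.
  apply/seteqP; split => y /=.
    by move=> yst; exists (pickle (fl k y)) => //; rewrite /E pickleK.
  by move=> [i _]; rewrite /E; case: (unpickle i) => // z [].
rewrite UE; apply/measurable_fun_bigcup => // i.
have Est : E i `<=` `[s, t] by rewrite UE => y yi; exists i.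
move: (Est) (mE i); rewrite /E; case: (unpickle i) => [z|] sub mEi; last first.
  exact: measurable_fun_set0.
apply: (eq_measurable_fun (fun y => L (x y) (q k z))).
  by move=> y; rewrite inE/= => -[_ ->].
apply: (measurable_funS (E := `[s, t]%classic)) => //.
apply: within_measurable.
apply: (@within_continuous_comp _ _ _ _ x (fun a => L a (q k z))) => //.
move=> a _; apply: (@continuous_comp _ _ _ (fun a => (a, q k z))
  (fun p : 'rV[R]_n * 'rV[R]_n => L p.1 p.2)); last exact: cL.
by apply: (@cvg_pair _ _ _ (nbhs a) (nbhs a) (nbhs (q k z)) _ _ _ (fun x => x) (fun=> q k z));
  [exact: cvg_id|exact: cvg_cst].
Qed.

(** Polymorphic in [T], so that curves, velocities, coordinates and extended real integrands are
    glued by one operation. *)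
Definition concat {R : realType} {T : Type} (a : R) (f g : R -> T) (y : R) : T :=
  if y <= a then f y else g (y - a).

Lemma itv_concat (R : realType) (a b : R) : 0 <= a -> 0 <= b ->
  `[0, a + b]%classic = `[0, a] `|` `]a, a + b].
Proof.
by move=> a0 b0; apply: itv_bndbnd_setU; rewrite bnd_simp// lerDl.
Qed.

Lemma measurable_concat [R : realType] [a b : R] [f g : R -> \bar R] :
  0 <= a -> 0 <= b ->
  measurable_fun `[0, a] f -> measurable_fun `[0, b] g ->
  measurable_fun `[0, a + b] (concat a f g).
Proof.
move=> a0 b0 mf mg; rewrite itv_concat//; apply/measurable_funU => //; split.
  apply: eq_measurable_fun mf => y; rewrite inE/= in_itv/= => /andP[_ ya].
  by rewrite /concat ya.
apply: (eq_measurable_fun (g \o center a)).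
  move=> y; rewrite inE/= in_itv/= => /andP[ay _].
  by rewrite /concat leNgt ay.
apply: (measurable_funS (E := `[0 + a, b + a]%classic)) => //.
  by rewrite add0r (addrC b); apply: subset_itvr; rewrite bnd_simp.
exact: measurable_fun_shift.
Qed.

Lemma integral_concat [R : realType] [a b : R] (f g : R -> \bar R) :
  0 <= a -> 0 <= b ->
  measurable_fun `[0, a] f -> measurable_fun `[0, b] g ->
  (\int[lebesgue_measure]_(y in `[0%R, (a + b)%R]) concat a f g y =
   \int[lebesgue_measure]_(y in `[0%R, a]) f y +
   \int[lebesgue_measure]_(y in `[0%R, b]) g y)%E.
Proof.
move=> a0 b0 mf mg; have := measurable_concat a0 b0 mf mg.
rewrite itv_concat// => mfg; rewrite integral_setU//; last first.
  apply/disj_setPS => y /= []; rewrite !in_itv/= => /andP[_ ya] /andP[ay _].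
  by move: ya; rewrite leNgt ay.
congr (_ + _)%E.
  apply: eq_integral => y; rewrite inE/= in_itv/= => /andP[_ ya].
  by rewrite /concat ya.
transitivity (\int[lebesgue_measure]_(y in `]a, (a + b)%R]) (g (center a y)))%E.
  apply: eq_integral => y; rewrite inE/= in_itv/= => /andP[ay _].
  by rewrite /concat leNgt ay.
have mga := measurable_fun_shift a _ _ _ mg.
rewrite integral_itv_obnd_cbnd; last first.
  apply: measurable_funS mga => //.
  by rewrite add0r (addrC b); apply: subset_itvr; rewrite bnd_simp.
by rewrite -(integral_shift a _ _ _ mg) add0r (addrC b).
Qed.

Lemma concat_comp [R : realType] [T U : Type] [a : R] [f g : R -> T] (h : T -> U) :
  h \o concat a f g = concat a (h \o f) (h \o g).
Proof. by apply/funext => y; rewrite /concat/=; case: ifP. Qed.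

Lemma integrable_concat [R : realType] [a b : R] [f g : R -> \bar R] :
  0 <= a -> 0 <= b ->
  (@lebesgue_measure R).-integrable `[0, a] f ->
  (@lebesgue_measure R).-integrable `[0, b] g ->
  (@lebesgue_measure R).-integrable `[0, a + b] (concat a f g).
Proof.
move=> a0 b0 /integrableP[mf fi] /integrableP[mg gi]; apply/integrableP; split.
  exact: measurable_concat.
have := integral_concat (abse \o f) (abse \o g) a0 b0.
rewrite -(concat_comp abse) => -> //; first exact: lte_add_pinfty.
  exact: measurableT_comp.
exact: measurableT_comp.
Qed.

Lemma Rintegral_concat (R : realType) (a b : R) (f g : R -> R) :
  0 <= a -> 0 <= b ->
  (@lebesgue_measure R).-integrable `[0, a] (EFin \o f) ->
  (@lebesgue_measure R).-integrable `[0, b] (EFin \o g) ->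
  \int[lebesgue_measure]_(y in `[0, a + b]) concat a f g y =
  \int[lebesgue_measure]_(y in `[0, a]) f y +
  \int[lebesgue_measure]_(y in `[0, b]) g y.
Proof.
move=> a0 b0 fi gi; rewrite /Rintegral.
have := integral_concat _ _ a0 b0 (measurable_int _ fi) (measurable_int _ gi).
rewrite -(concat_comp EFin) => ->.
by rewrite fineD//; [exact: integrable_fin_num fi|exact: integrable_fin_num gi].
Qed.

Lemma continuous_concat [R : realType] [T : topologicalType] [a b : R] [f g : R -> T] :
  0 <= a -> 0 <= b -> f a = g 0 ->
  {within `[0, a], continuous f} -> {within `[0, b], continuous g} ->
  {within `[0, a + b], continuous (concat a f g)}.
Proof.
move=> a0 b0 fg cf cg.
have -> : `[0, a + b]%classic = `[0, a] `|` `[a, a + b].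
  apply/seteqP; split => y /=; rewrite !in_itv/=.
    by move=> /andP[y0 yab]; case: (leP y a) => ?; [left|right]; apply/andP; split => //; lra.
  by move=> [] /andP[? ?]; apply/andP; split; lra.
apply: withinU_continuous; [exact: interval_closed|exact: interval_closed| |].
  apply: (@subspace_eq_continuous _ `[0, a]%classic _ f (concat a f g)) cf => y.
  rewrite inE/= in_itv/= => /andP[_ ya].
  by rewrite /concat ifT.
apply: (@subspace_eq_continuous _ `[a, a + b]%classic _ (g \o center a) (concat a f g)).
  move=> y; rewrite inE/= in_itv/= => /andP[ay _]; rewrite /concat.
  have [ya|//] := leP y a.
  by rewrite /= (@le_anti _ _ y a) ?ya// subrr fg.
apply/subspace_continuousP => y /=; rewrite in_itv/= => /andP[ay yab].
have /subspace_continuousP/(_ (y - a)) := cg.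
rewrite /= in_itv/= subr_ge0 ay lerBlDl => /(_ yab) H.
apply: cvg_comp H => A; rewrite /within/= => nA.
have cc : {for y, continuous (center a)} by apply: cvgB; [exact: cvg_id|exact: cvg_cst].
have := cc _ nA.
change (nbhs y (center a @^-1` (fun x => x \in `[0, b] -> A x)) ->
  nbhs y (fun z => z \in `[a, a + b] -> A (center a z))).
apply: filterS => z /= {}H.
by rewrite in_itv/= => /andP[? ?]; apply: H; rewrite in_itv/= subr_ge0 lerBlDl; apply/andP.
Qed.

Lemma continuous_coord [R : realType] [n : nat] [A : set R] [x : R -> 'rV[R]_n] i :
  {within A, continuous x} -> {within A, continuous (fun y => x y 0 i)}.
Proof.
move=> cx; apply: (@within_continuous_comp _ _ _ _ x (fun u : 'rV[R]_n => u 0 i)) => //.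
by move=> u _; exact: coord_continuous.
Qed.

Lemma test_function0 (R : realType) (s t : R) (phi : R -> R) (y : R) :
  test_function s t phi -> y \notin `]s, t[ -> phi y = 0.
Proof.
move=> [_ _ sub]; apply: contraNeq => phiy.
by apply: sub; apply: subset_closure.
Qed.

(** A test function of the long interval need not vanish at [a], so on each piece it is only a C^1
    function and the definition of weak derivative does not apply. Integration by parts leaves
    [phi a] times [x1 a] and minus [x2 0]. *)
Lemma weak_derivative_concat [R : realType] [n : nat] [a b : R]
    [x1 x2 v1 v2 : R -> 'rV[R]_n] : 0 < a -> 0 < b -> x1 a = x2 0 ->
  {within `[0, a], continuous x1} -> {within `[0, b], continuous x2} ->
  weak_derivative 0 a x1 v1 -> weak_derivative 0 b x2 v2 ->
  weak_derivative 0 (a + b) (concat a x1 x2) (concat a v1 v2).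
Proof.
move=> a0 b0 x12 cx1 cx2 [iv1 xv1] [iv2 xv2].
have coordE (f g : R -> 'rV[R]_n) (i : 'I_n) y :
    concat a f g y 0 i =
    concat a (fun y => f y 0 i) (fun y => g y 0 i) y.
  by rewrite /concat; case: ifP.
split=> [i|phi tphi i].
  have := integrable_concat (ltW a0) (ltW b0) (iv1 i) (iv2 i).
  by apply: eq_integrable => // y _; rewrite coordE /concat; case: ifP.
have phi0 : phi 0 = 0 by apply: test_function0 tphi _; rewrite in_itv/= ltxx.
have phiab : phi (a + b) = 0.
  by apply: test_function0 tphi _; rewrite in_itv/= ltxx andbF.
have [C1phi _ _] := tphi; have /C1P[dphi cdphi] := C1phi.
(* The translate of [phi] seen by the second curve, written in the affine form of
   [is_derive_affine]. *)
pose psi y := phi (1 * y + a).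
have dpsi y : is_derive y (1 : R) psi (derive1 phi (1 * y + a)).
  rewrite -[X in is_derive _ _ _ X]mulr1.
  apply: (@is_derive1_comp _ phi (fun y => 1 * y + a)); last exact: is_derive_affine.
  by apply: DeriveDef => //; rewrite derive1E.
have psi'E y : derive1 psi y = derive1 phi (1 * y + a).
  by rewrite derive1E (@derive_val _ _ _ _ _ _ _ (dpsi y)).
have C1psi : C1 (psi : R^o -> R).
  apply/C1P; split; first by move=> y; exact: (@ex_derive _ _ _ _ _ _ _ (dpsi y)).
  have -> : derive1 psi = derive1 phi \o (fun y => 1 * y + a).
    by apply/funext => y; exact: psi'E.
  by move=> y; apply: continuous_comp; [exact: continuous_affine|exact: cdphi].
have [_ cdpsi] := (C1P _ _).1 C1psi.
have cphi : continuous phi.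
  by move=> y; apply: differentiable_continuous; apply/derivable1_diffP.
have cpsi : continuous psi by move=> y; exact: is_derive_continuous (dpsi y).
have prodE (f g : R -> R) (h : R -> R) y :
    concat a f g y * h y =
    concat a (fun y => f y * h y) (fun y => g y * h (1 * y + a)) y.
  by rewrite /concat; case: ifP => // _; rewrite mul1r subrK.
have cx1i := continuous_coord i cx1.
have cx2i := continuous_coord i cx2.
have int_prod (f g h : R -> R) :
    (@lebesgue_measure R).-integrable `[0, a] (EFin \o f) ->
    (@lebesgue_measure R).-integrable `[0, b] (EFin \o g) ->
    continuous h ->
    \int[lebesgue_measure]_(y in `[0, a + b]) (concat a f g y * h y) =
    \int[lebesgue_measure]_(y in `[0, a]) (f y * h y) +
    \int[lebesgue_measure]_(y in `[0, b]) (g y * h (1 * y + a)).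
  move=> fi gi ch.
  have cha : continuous (h \o (fun y => 1 * y + a)).
    by move=> y; apply: continuous_comp; [exact: continuous_affine|exact: ch].
  rewrite -Rintegral_concat ?ltW//.
  - by apply: eq_Rintegral => y _; rewrite prodE.
  - by apply: integrable_mulr_within => //; exact: within_continuousT.
  - apply: integrable_mulr_within => //; apply: within_continuousT => y.
    exact: cha.
have E1 : \int[lebesgue_measure]_(y in `[0, a + b])
      (concat a x1 x2 y 0 i * derive1 phi y) =
    \int[lebesgue_measure]_(y in `[0, a]) (x1 y 0 i * derive1 phi y) +
    \int[lebesgue_measure]_(y in `[0, b]) (x2 y 0 i * derive1 psi y).
  rewrite (_ : derive1 psi = fun y => derive1 phi (1 * y + a)); last first.
    by apply/funext.
  rewrite -(int_prod (fun y => x1 y 0 i) (fun y => x2 y 0 i))//;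
    [|exact: within_integrable..].
  by apply: eq_Rintegral => y _; rewrite coordE.
have E2 : \int[lebesgue_measure]_(y in `[0, a + b])
      (concat a v1 v2 y 0 i * phi y) =
    \int[lebesgue_measure]_(y in `[0, a]) (v1 y 0 i * phi y) +
    \int[lebesgue_measure]_(y in `[0, b]) (v2 y 0 i * psi y).
  rewrite -(int_prod (fun y => v1 y 0 i) (fun y => v2 y 0 i))//.
  - by apply: eq_Rintegral => y _; rewrite coordE.
  - exact: (iv1 i).
  - exact: (iv2 i).
rewrite E1 E2.
rewrite (weak_integration_by_parts b0 cx2i (iv2 i)
  (fun phi tphi => xv2 phi tphi i) _ C1psi).
rewrite (weak_integration_by_parts a0 cx1i (iv1 i)
  (fun phi tphi => xv1 phi tphi i) _ C1phi).
have psi0 : psi 0 = phi a by rewrite /psi mulr0 add0r.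
have psib : psi b = 0 by rewrite /psi mul1r addrC.
by rewrite phi0 psi0 psib x12; ring.
Qed.

(** * The potential under concatenation and along segments *)

Lemma potential_lt (R : realType) (n : nat) (L : 'rV[R]_n -> 'rV[R]_n -> R)
    (Omega : set 'rV[R]_n) (x y : 'rV[R]_n) (c : \bar R) :
  (potential L Omega x y < c)%E <->
  exists t xi v, [/\ 0 < t, curves Omega 0 t x y xi, weak_derivative 0 t xi v &
    (\int[lebesgue_measure]_(s in `[0%R, t]) (L (xi s) (v s))%:E < c)%E].
Proof.
split.
  move=> /ereal_inf_lt[_ [t /= t0 <-]] /ereal_inf_lt[_ [xi [v [cxi wxi ->]]] lt_c].
  by exists t, xi, v.
move=> [t [xi [v [t0 cxi wxi lt_c]]]]; apply: le_lt_trans lt_c.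
apply: (@le_trans _ _ (action L Omega t x y)).
  by apply: ereal_inf_lbound; exists t.
by apply: ereal_inf_lbound; exists xi, v.
Qed.

(** Strict bounds yield actual curves to glue, although the infima need not be attained. *)
Lemma potential_concat [R : realType] [n : nat] [L : 'rV[R]_n -> 'rV[R]_n -> R]
    {Omega : set 'rV[R]_n} [x : 'rV[R]_n] (y z : 'rV[R]_n) (c d : \bar R) :
  continuous (fun p : 'rV[R]_n * 'rV[R]_n => L p.1 p.2) ->
  (potential L Omega x y < c)%E -> (potential L Omega y z < d)%E ->
  (potential L Omega x z < c + d)%E.
Proof.
move=> cL /potential_lt[a [x1 [v1 [a0 [[cx1 ix1 _] Ox1 x10 x1a] w1 lt_c]]]].
move=> /potential_lt[b [x2 [v2 [b0 [[cx2 ix2 _] Ox2 x20 x2b] w2 lt_d]]]].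
have x12 : x1 a = x2 0 by rewrite x1a x20.
have w12 := weak_derivative_concat a0 b0 x12 cx1 cx2 w1 w2.
apply/potential_lt; exists (a + b), (concat a x1 x2), (concat a v1 v2).
split => //; first exact: addr_gt0.
- split.
  + split; [exact: (continuous_concat (ltW a0) (ltW b0))| |by eexists; exact: w12].
    move=> i; have := integrable_concat (ltW a0) (ltW b0) (ix1 i) (ix2 i).
    by apply: eq_integrable => // s _; rewrite /concat; case: ifP.
  + move=> s; rewrite in_itv/= => /andP[s0 sab]; rewrite /concat.
    case: (leP s a) => sa; first by apply: Ox1; rewrite in_itv/= s0.
    by apply: Ox2; rewrite in_itv/= subr_ge0 (ltW sa) lerBlDl.
  + by rewrite /concat ltW.
  + by rewrite /concat gerDl leNgt b0/= addrC addKr.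
- have mL (t : R) (xi v : R -> 'rV[R]_n) : {within `[0, t], continuous xi} ->
      weak_derivative 0 t xi v ->
      measurable_fun `[0, t] (fun s => (L (xi s) (v s))%:E).
    move=> cxi [iv _]; apply/measurable_EFinP; apply: measurable_fun_continuous2 => // i.
    by apply/measurable_EFinP; exact: measurable_int (iv i).
  have := integral_concat _ _ (ltW a0) (ltW b0) (mL _ _ _ cx1 w1) (mL _ _ _ cx2 w2).
  move=> E; apply: (le_lt_trans _ (lteD lt_c lt_d)); rewrite -E le_eqVlt; apply/orP; left.
  by apply/eqP; apply: eq_integral => s _; rewrite /concat; case: ifP.
Qed.

Lemma potential_segment (R : realType) (n : nat) (L : 'rV[R]_n -> 'rV[R]_n -> R)
    (Omega : set 'rV[R]_n) (x y : 'rV[R]_n) (M : R) :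
  continuous (fun p : 'rV[R]_n * 'rV[R]_n => L p.1 p.2) ->
  0 < M -> (forall z w, `|w| <= 1 -> L z w <= M) ->
  (forall a, 0 <= a <= 1 -> closure Omega (x + a *: (y - x))) ->
  (potential L Omega x y <= (M * `|y - x|)%:E)%E.
Proof.
move=> cL M0 LM seg; apply/lee_addgt0Pr => e e0; rewrite -EFinD.
(* The extra [e / M] makes the duration positive even when [x = y], keeps the speed at most 1, and
   costs exactly [e]. *)
pose T := `|y - x| + e / M.
have T0 : 0 < T by apply: ltr_wpDl => //; exact: divr_gt0.
have -> : M * `|y - x| + e = M * T by rewrite /T; field; rewrite gt_eqF.
pose v : 'rV[R]_n := T^-1 *: (y - x).
pose xi (s : R) := x + s *: v.
have v1 : `|v| <= 1.
  rewrite normrZ gtr0_norm ?invr_gt0// mulrC ler_pdivrMr// mul1r /T lerDl.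
  by rewrite ltW// divr_gt0.
have coordE i : (fun s => xi s 0 i) = (fun s => v 0 i * s + x 0 i).
  by apply/funext => s; rewrite /xi !mxE; ring.
have cxi : continuous xi.
  by move=> s; apply: cvgD; [exact: cvg_cst|apply: cvgZ; [exact: cvg_id|exact: cvg_cst]].
have icst c : (@lebesgue_measure R).-integrable `[0, T] (EFin \o (fun=> c)).
  by apply: within_integrable; apply: within_continuousT => s; exact: cvg_cst.
have wxi : weak_derivative 0 T xi (fun=> v).
  split=> [i|phi tphi i]; first exact: icst.
  have [/C1P[dphi cdphi] _ _] := tphi.
  have isdphi s : is_derive s (1 : R) phi (derive1 phi s).
    by apply: DeriveDef => //; rewrite derive1E.
  have cphi : continuous phi by move=> s; exact: is_derive_continuous (isdphi s).
  have phi0 : phi 0 = 0 by apply: test_function0 tphi _; rewrite in_itv/= ltxx.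
  have phiT : phi T = 0 by apply: test_function0 tphi _; rewrite in_itv/= ltxx andbF.
  have ci := continuous_affine (v 0 i) (x 0 i).
  have D s : is_derive s (1 : R) ((fun s => v 0 i * s + x 0 i) \* phi)
      (xi s 0 i * derive1 phi s + v 0 i * phi s).
    rewrite (congr1 (fun f => f s) (coordE i)) (mulrC (v 0 i) (phi s)).
    exact: (is_deriveM (is_derive_affine (v 0 i) (x 0 i) s) (isdphi s)).
  have c1 : continuous (fun s => xi s 0 i * derive1 phi s).
    rewrite (_ : (fun s => _) = (fun s => (v 0 i * s + x 0 i) * derive1 phi s)).
      by move=> s; apply: cvgM; [exact: ci|exact: cdphi].
    by apply/funext => s; rewrite (congr1 (fun f => f s) (coordE i)).
  have c2 : continuous (fun s => v 0 i * phi s).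
    by move=> s; apply: cvgM; [exact: cvg_cst|exact: cphi].
  have := Rintegral_derive T0 D.
  rewrite RintegralD//; [|by apply: within_integrable; exact: within_continuousT..].
  rewrite /= phi0 phiT !mulr0 subrr => H.
  apply/eqP; rewrite -addr_eq0; apply/eqP; apply: H => s.
  by apply: cvgD; [exact: c1|exact: c2].
have LT := @within_integrable R 0 T (fun s => L (xi s) v).
have {LT} iL : (@lebesgue_measure R).-integrable `[0, T] (EFin \o (fun s => L (xi s) v)).
  apply: LT; apply: within_continuousT => s.
  apply: (@continuous_comp _ _ _ (fun s => (xi s, v))
    (fun p : 'rV[R]_n * 'rV[R]_n => L p.1 p.2)); last exact: cL.
  by apply: (@cvg_pair _ _ _ (nbhs s) (nbhs (xi s)) (nbhs v) _ _ _ xi (fun=> v));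
    [exact: cxi|exact: cvg_cst].
apply: (@le_trans _ _ (action L Omega T x y)).
  by apply: ereal_inf_lbound; exists T.
apply: (@le_trans _ _ (\int[lebesgue_measure]_(s in `[0%R, T]) (L (xi s) v)%:E)%E).
  apply: ereal_inf_lbound; exists xi, (fun=> v); split => //; split.
  - split; [exact: continuous_subspaceT| |by eexists; exact: wxi].
    move=> i; apply: within_integrable; rewrite coordE; apply: within_continuousT.
    exact: continuous_affine.
  - move=> s; rewrite in_itv/= => /andP[s0 sT]; rewrite /xi scalerA; apply: seg.
    by rewrite divr_ge0 ?(ltW T0)//= ler_pdivrMr// mul1r.
  - by rewrite /xi scale0r addr0.
  - by rewrite /xi scalerA divff ?gt_eqF// scale1r addrC subrK.
rewrite -(fineK (integrable_fin_num _ iL))// lee_fin.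
have -> : M * T = \int[lebesgue_measure]_(s in `[0, T]) M.
  by rewrite Rintegral_cst//= lebesgue_measure_itv/= lte_fin T0 sube0.
by apply: le_Rintegral => // s _; exact: LM.
Qed.

(** * Local geometry of Lipschitz domains *)

(** The triangle inequality phrased with real upper bounds, so that no sum of opposite infinities
    arises. *)
Definition triangular {R : realType} {T : Type} (P : T -> T -> \bar R) :=
  forall x y z a b, (P x y <= a%:E)%E -> (P y z <= b%:E)%E -> (P x z <= (a + b)%:E)%E.

Definition segment_bounded {R : realType} {V : normedModType R} (Omega : set V)
    (P : V -> V -> \bar R) (M : R) :=
  forall x y, (forall a, 0 <= a <= 1 -> closure Omega (x + a *: (y - x))) ->
    (P x y <= (M * `|y - x|)%:E)%E.

(** The part of the segment inside [Omega] is nonempty, relatively open and, by the last hypothesis,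
    relatively closed; a segment is connected. *)
Lemma segment_open [R : realType] [V : normedModType R] {Omega : set V} (x y : V) :
  open Omega -> Omega x ->
  (forall a, 0 <= a <= 1 -> closure Omega (x + a *: (y - x)) -> Omega (x + a *: (y - x))) ->
  forall a, 0 <= a <= 1 -> Omega (x + a *: (y - x)).
Proof.
move=> oO Ox clO; pose h (a : R) := x + a *: (y - x).
have ch : continuous h.
  by move=> a; apply: cvgD; [exact: cvg_cst|apply: cvgZ; [exact: cvg_id|exact: cvg_cst]].
have cA : connected (h @` `[0, 1]).
  apply: connected_continuous_connected; first exact: segment_connected.
  exact: continuous_subspaceT.
suff E : h @` `[0, 1] `&` Omega = h @` `[0, 1].
  move=> a a01; have : (h @` `[0, 1]) (h a) by exists a => //=; rewrite in_itv.
  by rewrite -E => -[].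
apply: cA.
- exists x; split=> //; exists 0; first by rewrite /= in_itv/= lexx ler01.
  by rewrite /h scale0r addr0.
- by exists Omega.
- exists (closure Omega); first exact: closed_closure.
  apply/seteqP; split => z [[a a01 <-] Oz]; split; try by exists a.
    exact: subset_closure.
  by apply: clO => //; rewrite /= in_itv in a01.
Qed.

(* [F] measures the height above a Lipschitz graph in the direction [w];
   two points above the graph are joined by climbing along [w], crossing
   horizontally and descending. *)
Definition height {R : realType} {V : normedModType R} (F : V -> R) (w : V) (K : R) :=
  [/\ 0 <= K, forall x y, F y - F x <= K * `|y - x| &
      forall x s, F (x + s *: w) = F x + s].

(** Exchanges the two sides of the graph, so that paths need only be built on the upper side. *)
Lemma height_opp [R : realType] [V : normedModType R] [F : V -> R] [w : V] [K : R] :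
  height F w K -> height (fun x => - F x) (- w) K.
Proof.
move=> [K0 KF Fw]; split=> // [x y|x s].
  by rewrite opprK addrC distrC; exact: KF.
by rewrite scalerN -scaleNr Fw opprB addrC.
Qed.

(** One constant with two uses: the path with climbing height [(K + 1) * |y - x|] has length
    [climb w K * |y - x|], and if its end points lie in a ball of radius [r] it stays in the
    concentric ball of radius [r * climb w K]. *)
Definition climb {R : realType} {V : normedModType R} (w : V) (K : R) : R :=
  1 + 2 * (K + 1) * `|w|.

Section Height.
Context {R : realType} {n : nat} {Omega : set 'rV[R]_n} {F : 'rV[R]_n -> R}.
Context {w : 'rV[R]_n} (p : 'rV[R]_n) {K : R}.
Context (hF : height F w K).

Lemma climb_ge1 : 1 <= climb w K.
Proof. by case: hF => K0 _ _; rewrite /climb lerDl !mulr_ge0// addr_ge0. Qed.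

Lemma convex_ball_lt [r a : R] [x y : 'rV[R]_n] : 0 <= a <= 1 ->
  `|x - p| < r -> `|y - p| < r -> `|x + a *: (y - x) - p| < r.
Proof.
move=> /andP[a0 a1] xr yr.
have -> : x + a *: (y - x) - p = (1 - a) *: (x - p) + a *: (y - p).
  by apply/rowP => i; rewrite !mxE; ring.
apply: le_lt_trans (ler_normD _ _) _.
rewrite !normrZ ger0_norm ?subr_ge0// (ger0_norm a0).
have [->|a1'] := eqVneq a 1; first by rewrite subrr mul0r add0r mul1r.
have {}a1 : a < 1 by rewrite lt_neqAle a1'.
have : (1 - a) * `|x - p| < (1 - a) * r by rewrite ltr_pM2l// subr_gt0.
have : a * `|y - p| <= a * r by rewrite ler_wpM2l// ltW.
lra.
Qed.

Lemma climb_ball [r a b : R] [x y : 'rV[R]_n] : 0 <= a <= 1 -> 0 <= b <= 1 ->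
  `|x - p| < r -> `|y - p| < r ->
  `|x + a *: (y - x) + (b * ((K + 1) * `|y - x|)) *: w - p| < r * climb w K.
Proof.
move=> a01 /andP[b0 b1] xr yr; have [K0 _ _] := hF.
have yx : `|y - x| <= 2 * r.
  have -> : y - x = (y - p) - (x - p) by rewrite opprB addrA subrK.
  by apply: le_trans (ler_normB _ _) _; lra.
have c := convex_ball_lt a01 xr yr.
rewrite addrAC; apply: le_lt_trans (ler_normD _ _) _.
rewrite normrZ ger0_norm ?mulr_ge0 ?addr_ge0// /climb mulrDr mulr1; apply: ltr_leD => //.
have -> : r * (2 * (K + 1) * `|w|) = r * (2 * (K + 1)) * `|w| by ring.
apply: ler_wpM2r => //.
have : (K + 1) * `|y - x| <= (K + 1) * (2 * r) by rewrite ler_wpM2l// addr_ge0.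
have : b * ((K + 1) * `|y - x|) <= 1 * ((K + 1) * `|y - x|).
  by rewrite ler_wpM2r// mulr_ge0// addr_ge0.
lra.
Qed.

(** The crossing loses at most [K * |y - x|] of height; climbing with [K + 1] leaves a surplus of at
    least [|y - x|]. *)
Lemma climb_pos (a b : R) (x y : 'rV[R]_n) : 0 <= a <= 1 -> x != y ->
  0 <= F x -> 0 < F (x + a *: (y - x) + ((K + 1) * `|y - x|) *: w).
Proof.
move=> /andP[a0 a1] xy Fx; have [K0 KF Fw] := hF.
have yx : 0 < `|y - x| by rewrite normr_gt0 subr_eq0 eq_sym.
rewrite Fw; have := KF (x + a *: (y - x)) x.
rewrite opprD addrA subrr add0r normrN normrZ ger0_norm// => H.
have : K * (a * `|y - x|) <= K * `|y - x|.
  by rewrite ler_wpM2l// ger_pMl.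
lra.
Qed.

(** The path from [z] to [y] keeps [F] positive and hence meets no boundary point, so none of its
    three segments can leave [Omega]. *)
Lemma above_sub (r : R) (z : 'rV[R]_n) : open Omega ->
  (forall y, `|y - p| < r * climb w K -> boundary Omega y -> F y = 0) ->
  Omega z -> `|z - p| < r -> 0 < F z ->
  forall y, `|y - p| < r -> 0 < F y -> Omega y.
Proof.
move=> oO bF Oz zr Fz y yr Fy; have [K0 KF Fw] := hF.
have [->//|yz] := eqVneq y z; rewrite eq_sym in yz.
have clO u : `|u - p| < r * climb w K -> 0 < F u -> closure Omega u -> Omega u.
  move=> ur Fu cu; apply: contrapT => nOu.
  have : boundary Omega u by split=> // /interior_subset.
  by move=> /(bF _ ur) Fu0; rewrite Fu0 ltxx in Fu.
pose h := (K + 1) * `|y - z|.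
have h0 : 0 <= h by rewrite mulr_ge0// addr_ge0.
have b01 : 0 <= (1 : R) <= 1 by rewrite lexx ler01.
have b00 : 0 <= (0 : R) <= 1 by rewrite lexx ler01.
have s1 : Omega (z + 1 *: (z + h *: w - z)).
  apply: (segment_open z (z + h *: w)) => // a a01.
  have -> : z + a *: (z + h *: w - z) = z + 0 *: (y - z) + (a * h) *: w.
    by apply/rowP => i; rewrite !mxE; ring.
  apply: clO; first exact: climb_ball.
  by rewrite scale0r addr0 Fw ltr_pwDl// mulr_ge0//; case/andP: a01.
rewrite scale1r addrC subrK in s1.
have s2 : Omega (z + h *: w + 1 *: (y + h *: w - (z + h *: w))).
  apply: (segment_open (z + h *: w) (y + h *: w)) => // a a01.
  have -> : z + h *: w + a *: (y + h *: w - (z + h *: w)) =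
      z + a *: (y - z) + (1 * h) *: w.
    by apply/rowP => i; rewrite !mxE; ring.
  apply: clO; first exact: climb_ball.
  by rewrite mul1r; apply: climb_pos => //; exact: ltW.
rewrite scale1r addrC subrK in s2.
have s3 : Omega (y + h *: w + 1 *: (y - (y + h *: w))).
  apply: (segment_open (y + h *: w) y) => // a /andP[a0 a1].
  have -> : y + h *: w + a *: (y - (y + h *: w)) =
      z + 1 *: (y - z) + ((1 - a) * h) *: w.
    by apply/rowP => i; rewrite !mxE; ring.
  apply: clO; first by apply: climb_ball => //; apply/andP; split; lra.
  rewrite (_ : z + 1 *: (y - z) = y); last by rewrite scale1r addrC subrK.
  by rewrite Fw ltr_pwDl// mulr_ge0// subr_ge0.
by move: s3; rewrite scale1r addrC subrK.
Qed.

Lemma above_path (r M : R) (P : 'rV[R]_n -> 'rV[R]_n -> \bar R) (x y : 'rV[R]_n) :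
  triangular P -> segment_bounded Omega P M ->
  (forall u, `|u - p| < r * climb w K -> 0 < F u -> Omega u) ->
  closure Omega x -> closure Omega y -> `|x - p| < r -> `|y - p| < r ->
  0 <= F x -> 0 <= F y -> (P x y <= (M * climb w K * `|y - x|)%:E)%E.
Proof.
move=> tri seg FO cx cy xr yr Fx Fy; have [K0 KF Fw] := hF.
(* For equal points the climb has height 0 and gains nothing; the constant segment gives
   [P x x <= 0]. *)
have [<-|xy] := eqVneq x y.
  apply: le_trans (seg x x _) _.
    by move=> a _; rewrite subrr scaler0 addr0.
  by rewrite subrr normr0 !mulr0.
have yx0 : 0 < `|y - x| by rewrite normr_gt0 subr_eq0 eq_sym.
pose h := (K + 1) * `|y - x|.
have h0 : 0 < h by rewrite mulr_gt0// ltr_wpDl.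
(* The foot [u] may lie on the graph, where only membership in the closure is known; every higher
   point is strictly above. *)
have vertical (u : 'rV[R]_n) a : closure Omega u -> 0 <= F u -> 0 <= a <= 1 ->
    `|u + (a * h) *: w - p| < r * climb w K ->
    closure Omega (u + (a * h) *: w).
  move=> cu Fu /andP[a0 a1] ur; have [->|a00] := eqVneq a 0.
    by rewrite mul0r scale0r addr0.
  apply: subset_closure; apply: FO => //; rewrite Fw ltr_wpDl// mulr_gt0//.
  by rewrite lt_neqAle eq_sym a00.
have b01 : 0 <= (1 : R) <= 1 by rewrite lexx ler01.
have b00 : 0 <= (0 : R) <= 1 by rewrite lexx ler01.
have P1 : (P x (x + h *: w)%R <= (M * `|h *: w|)%:E)%E.
  have -> : h *: w = x + h *: w - x by rewrite addrC addKr.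
  rewrite [X in P x X](_ : _ = x + h *: w); last by rewrite addrCA subrr addr0.
  apply: seg => a a01.
  have -> : x + a *: (x + h *: w - x) = x + (a * h) *: w.
    by apply/rowP => i; rewrite !mxE; ring.
  apply: vertical => //.
  have := climb_ball b00 a01 xr yr.
  by rewrite scale0r addr0.
have P2 : (P (x + h *: w)%R (y + h *: w)%R <= (M * `|y - x|)%:E)%E.
  have -> : y - x = y + h *: w - (x + h *: w) by apply/rowP => i; rewrite !mxE; ring.
  apply: seg => a a01.
  have -> : x + h *: w + a *: (y + h *: w - (x + h *: w)) =
      x + a *: (y - x) + (1 * h) *: w.
    by apply/rowP => i; rewrite !mxE; ring.
  apply: subset_closure; apply: FO; first exact: climb_ball.
  by rewrite mul1r; exact: climb_pos.
have P3 : (P (y + h *: w)%R y <= (M * `|h *: w|)%:E)%E.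
  have -> : `|h *: w| = `|y - (y + h *: w)|.
    by rewrite opprD addrA subrr add0r normrN.
  apply: seg => a /andP[a0 a1].
  have -> : y + h *: w + a *: (y - (y + h *: w)) = y + ((1 - a) * h) *: w.
    by apply/rowP => i; rewrite !mxE; ring.
  have a01 : 0 <= 1 - a <= 1 by apply/andP; split; lra.
  apply: vertical => //.
  have := climb_ball b01 a01 xr yr.
  by rewrite scale1r [x + _]addrC subrK.
have := tri _ _ _ _ _ (tri _ _ _ _ _ P1 P2) P3.
rewrite normrZ gtr0_norm// /climb /h.
by rewrite [X in (_ <= X%:E)%E -> _](_ : _ = M * (1 + 2 * (K + 1) * `|w|) * `|y - x|)//; ring.
Qed.

End Height.

Lemma lipschitz_bound (R : realType) (n : nat) (f : 'rV[R]_n -> R) : lipschitz f ->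
  exists K, 0 <= K /\ forall x y, `|f y - f x| <= K * `|y - x|.
Proof.
move=> [M [_ HM]]; exists (Num.max M 0 + 1); split.
  by rewrite addr_ge0// le_max lexx orbT.
move=> x y.
have : M < Num.max M 0 + 1 by rewrite ltr_pwDr// le_max lexx.
by move=> /HM/(_ (y, x))/=; apply.
Qed.

Lemma mulmx_bound [R : realType] [m n : nat] (Q : 'M[R]_(m, n)) :
  exists c, 0 <= c /\ forall v : 'rV[R]_m, `|v *m Q| <= c * `|v|.
Proof.
pose c := \sum_k \sum_j `|Q j k|.
have c0 : 0 <= c by apply: sumr_ge0 => k _; apply: sumr_ge0.
exists c; split=> // v; apply: rV_norm_le => [|k]; first exact: mulr_ge0.
rewrite !mxE; apply: le_trans (ler_norm_sum _ _ _) _.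
apply: (@le_trans _ _ (\sum_j `|Q j k| * `|v|)).
  by apply: ler_sum => j _; rewrite normrM mulrC; apply: ler_wpM2l => //; exact: rV_norm_ge.
rewrite -mulr_suml ler_wpM2r// /c (bigD1 k)//= lerDl.
by apply: sumr_ge0 => i _; apply: sumr_ge0.
Qed.

Lemma lipschitz_domain_height [R : realType] [n : nat] {Omega : set 'rV[R]_n.+1}
    [p : 'rV[R]_n.+1] :
  lipschitz_domain Omega -> boundary Omega p ->
  exists F w K, height F w K /\
    \forall y \near p, boundary Omega y <-> F y = 0.
Proof.
move=> [_ lip] /lip[Q [gamma [QQ /lipschitz_bound[K [K0 lg]] bd]]].
have QTQ : Q^T *m Q = 1%:M by exact: mulmx1C.
have [c [c0 Qc]] := mulmx_bound Q.
(* The signed vertical distance to the graph in rotated coordinates. The factor [c] in the constant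
   appears because an orthogonal matrix need not preserve the sup norm. *)
exists (fun y => (y *m Q) 0 ord_max - gamma (col' ord_max (y *m Q))).
exists (delta_mx 0 ord_max *m Q^T), ((1 + K) * c); split; last first.
  by apply: filterS bd => y ->; split => [->|/subr0_eq//]; rewrite subrr.
split; first by rewrite mulr_ge0// addr_ge0.
- move=> x y; have xyQ : y *m Q - x *m Q = (y - x) *m Q by rewrite mulmxBl.
  have h1 : (y *m Q) 0 ord_max - (x *m Q) 0 ord_max <= `|(y - x) *m Q|.
    by apply: le_trans (rV_norm_ge _ ord_max); rewrite -xyQ !mxE ler_norm.
  have h2 : `|gamma (col' ord_max (y *m Q)) - gamma (col' ord_max (x *m Q))| <=
      K * `|(y - x) *m Q|.
    apply: le_trans (lg _ _) _; apply: ler_wpM2l => //.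
    apply: rV_norm_le => // i.
    by have := rV_norm_ge ((y - x) *m Q) (lift ord_max i); rewrite -xyQ !mxE.
  have h3 := Qc (y - x).
  have h4 : (1 + K) * `|(y - x) *m Q| <= (1 + K) * (c * `|y - x|).
    by rewrite ler_wpM2l// addr_ge0.
  move: h2; rewrite ler_norml => /andP[h2 _].
  by rewrite -mulrA; lra.
- move=> x s; rewrite mulmxDl -scalemxAl -mulmxA QTQ mulmx1.
  rewrite [col' _ _](_ : _ = col' ord_max (x *m Q)); last first.
    by apply/rowP => i; rewrite !mxE/= eq_sym (negbTE (neq_lift _ _)) mulr0 addr0.
  by rewrite !mxE !eqxx mulr1; ring.
Qed.

(* Either side of the graph lies in [Omega] or avoids it; points on opposite
   sides are joined by a segment, as both sides then lie in [Omega]. *)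
Lemma boundary_local_bound [R : realType] [n : nat] {Omega : set 'rV[R]_n}
    [F : 'rV[R]_n -> R] [w p : 'rV[R]_n] [K M : R]
    [P : 'rV[R]_n -> 'rV[R]_n -> \bar R] :
  open Omega -> 0 < M -> triangular P -> segment_bounded Omega P M ->
  height F w K -> boundary Omega p ->
  (\forall y \near p, boundary Omega y <-> F y = 0) ->
  exists d, 0 < d /\ forall x y, closure Omega x -> closure Omega y ->
    `|x - p| < d -> `|y - p| < d ->
    (P x y <= (M * climb w K * `|y - x|)%:E)%E.
Proof.
move=> oO M0 tri seg hF bp /nbhs_normP[r /= r0 bd].
pose k := climb w K.
have k1 : 1 <= k by exact: climb_ge1 hF.
have k0 : 0 < k by exact: lt_le_trans k1.
(* Two nested uses of [climb]: paths between points of the [d1] ball stay in the [r] ball, where the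
   boundary is the graph; paths between points of the [d2] ball stay in the [d1] ball, where whole
   sides are known to lie in [Omega]. *)
pose d1 := r / k; pose d2 := d1 / k.
have d10 : 0 < d1 by exact: divr_gt0.
have d20 : 0 < d2 by exact: divr_gt0.
have d1k : d1 * k = r by rewrite /d1 divfK// gt_eqF.
have d2k : d2 * k = d1 by rewrite /d2 divfK// gt_eqF.
have d21 : d2 <= d1 by rewrite -d2k ler_peMr// ltW.
have d1r : d1 <= r by rewrite -d1k ler_peMr// ltW.
have kN : climb (- w) K = k by rewrite /k /climb normrN.
have hN := height_opp hF.
have bdF y : `|y - p| < r -> boundary Omega y <-> F y = 0.
  by move=> yr; apply: bd; rewrite /= distrC.
have clO y : `|y - p| < r -> closure Omega y -> F y != 0 -> Omega y.
  move=> yr cy /eqP Fy; apply: contrapT => nOy; apply: Fy; apply/(bdF _ yr).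
  by split=> // /interior_subset.
have up z : Omega z -> `|z - p| < d1 -> 0 < F z ->
    forall y, `|y - p| < d1 -> 0 < F y -> Omega y.
  move=> Oz zd Fz y yd Fy.
  apply: (above_sub p hF d1 z) => // u.
  by rewrite -/k d1k => ur /(bdF _ ur).
have down z : Omega z -> `|z - p| < d1 -> F z < 0 ->
    forall y, `|y - p| < d1 -> F y < 0 -> Omega y.
  move=> Oz zd Fz y yd Fy.
  apply: (above_sub p hN d1 z) => //; rewrite ?oppr_gt0//.
  by move=> u; rewrite kN d1k => ur /(bdF _ ur) ->; rewrite oppr0.
have pathup : (forall u, `|u - p| < d1 -> 0 < F u -> Omega u) -> forall x y,
    closure Omega x -> closure Omega y -> `|x - p| < d2 -> `|y - p| < d2 ->
    0 <= F x -> 0 <= F y -> (P x y <= (M * k * `|y - x|)%:E)%E.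
  move=> O1 x y cx cy xd yd Fx Fy.
  apply: (above_path p hF d2 M P x y tri seg _ cx cy xd yd Fx Fy) => u.
  by rewrite -/k d2k; exact: O1.
have pathdown : (forall u, `|u - p| < d1 -> F u < 0 -> Omega u) -> forall x y,
    closure Omega x -> closure Omega y -> `|x - p| < d2 -> `|y - p| < d2 ->
    F x <= 0 -> F y <= 0 -> (P x y <= (M * k * `|y - x|)%:E)%E.
  move=> O1 x y cx cy xd yd Fx Fy; rewrite -kN.
  apply: (above_path p hN d2 M P x y tri seg _ cx cy xd yd); rewrite ?oppr_ge0// => u.
  by rewrite kN d2k oppr_gt0; exact: O1.
(* Here the whole [d1] ball lies in the closure, since its points with [F u = 0] are boundary
   points; the straight segment is admissible. *)
have mixed : (forall u, `|u - p| < d1 -> 0 < F u -> Omega u) ->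
    (forall u, `|u - p| < d1 -> F u < 0 -> Omega u) -> forall x y,
    `|x - p| < d2 -> `|y - p| < d2 -> (P x y <= (M * k * `|y - x|)%:E)%E.
  move=> O1 O2 x y xd yd; apply: (@le_trans _ _ (M * `|y - x|)%:E); last first.
    by rewrite lee_fin ler_wpM2r// ler_peMr// ltW.
  apply: seg => a a01.
  have := convex_ball_lt p a01 (lt_le_trans xd d21) (lt_le_trans yd d21).
  set u := x + _ => ud.
  have [Fu|Fu|Fu] := ltgtP (F u) 0.
  - by apply: subset_closure; exact: O2.
  - by apply: subset_closure; exact: O1.
  - by have [] := (bdF u (lt_le_trans ud d1r)).2 Fu.
have sgn x : closure Omega x -> `|x - p| < d2 -> F x != 0 ->
    (0 < F x -> forall u, `|u - p| < d1 -> 0 < F u -> Omega u) /\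
    (F x < 0 -> forall u, `|u - p| < d1 -> F u < 0 -> Omega u).
  move=> cx xd Fx; have xd1 := lt_le_trans xd d21.
  have Ox := clO _ (lt_le_trans xd1 d1r) cx Fx.
  by split=> Fx0; [exact: up Ox xd1 Fx0|exact: down Ox xd1 Fx0].
(* When [x] and [y] are both on the graph they do not tell which side is in [Omega]; the sign of
   [F z] does. *)
have [z [Oz zd]] : exists z, Omega z /\ `|z - p| < d2.
  have [cp _] := bp.
  have /cp[z [Oz zd]] : nbhs p (ball p d2) by exact: nbhsx_ballx.
  by exists z; split=> //; rewrite distrC; move: zd; rewrite -ball_normE.
have Fz : F z != 0.
  apply/eqP => Fz0.
  have [_] := (bdF z (lt_le_trans zd (le_trans d21 d1r))).2 Fz0.
  by apply; move: oO; rewrite openE; apply.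
have [zup zdown] := sgn z (subset_closure Oz) zd Fz.
exists d2; split=> // x y cx cy xd yd.
have [Fx|Fx|Fx] := ltgtP (F x) 0; have [Fy|Fy|Fy] := ltgtP (F y) 0.
- by apply: pathdown => //; [exact: (sgn x cx xd (ltr0_neq0 Fx)).2 Fx|exact: ltW|exact: ltW].
- by apply: mixed => //;
    [exact: (sgn y cy yd (lt0r_neq0 Fy)).1 Fy|
     exact: (sgn x cx xd (ltr0_neq0 Fx)).2 Fx].
- by apply: pathdown => //; [exact: (sgn x cx xd (ltr0_neq0 Fx)).2 Fx|exact: ltW|rewrite Fy].
- by apply: mixed => //;
    [exact: (sgn x cx xd (lt0r_neq0 Fx)).1 Fx|
     exact: (sgn y cy yd (ltr0_neq0 Fy)).2 Fy].
- by apply: pathup => //; [exact: (sgn x cx xd (lt0r_neq0 Fx)).1 Fx|exact: ltW|exact: ltW].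
- by apply: pathup => //; [exact: (sgn x cx xd (lt0r_neq0 Fx)).1 Fx|exact: ltW|rewrite Fy].
- by apply: pathdown => //; [exact: (sgn y cy yd (ltr0_neq0 Fy)).2 Fy|rewrite Fx|exact: ltW].
- by apply: pathup => //; [exact: (sgn y cy yd (lt0r_neq0 Fy)).1 Fy|rewrite Fx|exact: ltW].
- move: Fz; rewrite neq_lt => /orP[Fz|Fz].
    by apply: pathdown => //; [exact: zdown|rewrite Fx|rewrite Fy].
  by apply: pathup => //; [exact: zup|rewrite Fx|rewrite Fy].
Qed.

Lemma lipschitz_domain_local_bound [R : realType] [n : nat] {Omega : set 'rV[R]_n.+1}
    [P : 'rV[R]_n.+1 -> 'rV[R]_n.+1 -> \bar R] [M : R] [p : 'rV[R]_n.+1] :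
  lipschitz_domain Omega -> 0 < M -> triangular P ->
  segment_bounded Omega P M -> closure Omega p ->
  exists d C, [/\ 0 < d, 0 <= C & forall x y, closure Omega x -> closure Omega y ->
    `|x - p| < d -> `|y - p| < d -> (P x y <= (C * `|y - x|)%:E)%E].
Proof.
move=> lip M0 tri seg cp; have [[oO _ _] _] := lip.
have [Op|nOp] := pselect (Omega p).
  have : nbhs p Omega by move: oO; rewrite openE; apply.
  move=> /nbhs_normP[d /= d0 dO]; exists d, M; split=> //; first exact: ltW.
  move=> x y _ _ xd yd; apply: seg => a a01; apply: subset_closure; apply: dO => /=.
  by rewrite distrC; exact: convex_ball_lt.
have bp : boundary Omega p by split=> // /interior_subset.
have [F [w [K [hF bd]]]] := lipschitz_domain_height lip bp.
have [d [d0 H]] := boundary_local_bound oO M0 tri seg hF bp bd.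
exists d, (M * climb w K); split=> //.
by rewrite mulr_ge0// ?ltW//; apply: lt_le_trans (climb_ge1 hF).
Qed.

(** * Global bounds on the potential *)

Lemma near_covering_nbhs [I : Type] [X : topologicalType] [F : set_system I]
    [A : set X] [P : I -> X -> Prop] : Filter F -> compact A ->
  (forall x, A x -> exists U V, [/\ nbhs x U, F V & forall y i, U y -> V i -> P i y]) ->
  \forall i \near F, A `<=` P i.
Proof.
move=> FF /compact_near_coveringP cA H; apply: cA => x Ax.
have [U [V [xU FV UV]]] := H x Ax.
by exists (U, V) => // -[y i] /= [Uy Vi]; exact: UV.
Qed.

Lemma bounded_closure [R : realType] [V : normedModType R] [A : set V] :
  bounded_set A -> exists M, forall x, closure A x -> `|x| <= M.
Proof.
move=> [M [_ HM]]; exists (M + 1 + 1) => x cx.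
have /cx[y [Ay]] : nbhs x (ball x 1) by exact: nbhsx_ballx.
rewrite -ball_normE/= => xy.
have yM : `|y| <= M + 1 by apply: (HM (M + 1)) => //; rewrite ltrDl.
have -> : x = y + (x - y) by rewrite addrC subrK.
by apply: le_trans (ler_normD _ _) _; rewrite lerD// ltW.
Qed.

Lemma compact_closure_bounded (R : realType) (n : nat) (A : set 'rV[R]_n) :
  bounded_set A -> compact (closure A).
Proof.
move=> bA; apply: bounded_closed_compact; last exact: closed_closure.
have [M HM] := bounded_closure bA.
exists M; split; first exact: num_real.
by move=> K MK x cx; apply: le_trans (ltW MK); exact: HM.
Qed.

Lemma boundary_nonempty [R : realType] [n : nat] {Omega : set 'rV[R]_n.+1} :
  open Omega -> Omega !=set0 -> bounded_set Omega -> boundary Omega !=set0.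
Proof.
move=> oO [x Ox] /bounded_closure[M HM]; apply: contrapT => bd0.
(* A point of norm greater than [M]: a segment towards it that met no boundary point would stay in
   [Omega]. *)
pose y := x + const_mx (`|M| + `|x| + 1).
have : Omega (x + 1 *: (y - x)).
  apply: (segment_open x y oO Ox); last by rewrite ler01 lexx.
  move=> a _ cl; apply: contrapT => nO; apply: bd0; exists (x + a *: (y - x)).
  by split=> // /interior_subset.
rewrite scale1r addrC subrK => /subset_closure/HM.
have := rV_norm_ge (y - x) 0; rewrite !mxE addrC addKr => H1 H2.
have := ler_normB y x.
have : `|M| + `|x| + 1 <= `| `|M| + `|x| + 1| by rewrite ler_norm.
have := ler_norm M.
lra.
Qed.

(** The points reached from [x] at finite cost form a set [B] open and closed in the closure of
    [Omega]. Local bounds out of a point give openness, those into it give closedness. *)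
Lemma finite_bound [R : realType] [n : nat] {Omega : set 'rV[R]_n.+1}
    [P : 'rV[R]_n.+1 -> 'rV[R]_n.+1 -> \bar R] [M : R] :
  lipschitz_domain Omega -> 0 < M -> triangular P ->
  segment_bounded Omega P M ->
  forall x y, closure Omega x -> closure Omega y -> exists c, (P x y <= c%:E)%E.
Proof.
move=> lip M0 tri seg x y cx cy; have [[oO cO _] _] := lip.
have loc p (cp : closure Omega p) : exists d, 0 < d /\ forall z, closure Omega z ->
    `|z - p| < d -> (exists c, (P z p <= c%:E)%E) /\ (exists c, (P p z <= c%:E)%E).
  have [d [C [d0 C0 H]]] := lipschitz_domain_local_bound lip M0 tri seg cp.
  exists d; split=> // z cz zd; have pd : `|p - p| < d by rewrite subrr normr0.
  by split; eexists; apply: H.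
pose B := closure Omega `&` [set z | exists c, (P x z <= c%:E)%E].
suff E : B = closure Omega by move: cy; rewrite -E => -[].
apply: (connected_closure cO).
- exists x; split=> //; have [d [d0 H]] := loc x cx.
  by have [] := H x cx; rewrite ?subrr ?normr0.
(* The implication converts relative openness in the closure into openness in the whole space. *)
- exists (interior [set z | closure Omega z -> exists c, (P x z <= c%:E)%E]).
    exact: open_interior.
  apply/seteqP; split => z /= [cz].
    move=> [c xz]; split=> //; have [d [d0 H]] := loc z cz.
    have : nbhs z (ball z d) by exact: nbhsx_ballx.
    apply: filterS => z'; rewrite -ball_normE/= distrC => z'd cz'.
    have [_ [c' zz']] := H z' cz' z'd.
    by exists (c + c'); exact: tri xz zz'.
  by move=> /interior_subset/(_ cz) ?; split.
- exists (closure B); first exact: closed_closure.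
  apply/seteqP; split => z [cz Bz]; split=> //; first exact: subset_closure.
  have [d [d0 H]] := loc z cz.
  have /Bz[z' [[cz' [c xz']]]] : nbhs z (ball z d) by exact: nbhsx_ballx.
  rewrite -ball_normE/= distrC => z'd; have [[c' z'z] _] := H z' cz' z'd.
  by exists (c + c'); exact: tri xz' z'z.
Qed.

(** Compactness of the set of pairs: near the diagonal the local estimate applies, while away from
    it [|y - x|] is bounded below and any finite bound on [P] becomes linear for large [C]. *)
Lemma global_bound [R : realType] [n : nat] {Omega : set 'rV[R]_n.+1}
    [P : 'rV[R]_n.+1 -> 'rV[R]_n.+1 -> \bar R] [M : R] :
  lipschitz_domain Omega -> bounded_set Omega -> 0 < M -> triangular P ->
  segment_bounded Omega P M ->
  exists C, 0 <= C /\ forall x y, closure Omega x -> closure Omega y ->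
    (P x y <= (C * `|y - x|)%:E)%E.
Proof.
move=> lip bO M0 tri seg.
have loc := lipschitz_domain_local_bound lip M0 tri seg.
(* The second alternative allows full neighbourhoods in the product, including points outside the
   closure. *)
pose Q (C : R) (z : 'rV[R]_n.+1 * 'rV[R]_n.+1) :=
  (P z.1 z.2 <= (C * `|z.2 - z.1|)%:E)%E \/ ~ (closure Omega z.1 /\ closure Omega z.2).
have cK : compact (closure Omega `*` closure Omega).
  by apply: compact_setX; exact: compact_closure_bounded.
have nballx (p : 'rV[R]_n.+1) d : 0 < d -> nbhs p [set x | `|x - p| < d].
  move=> d0; have : nbhs p (ball p d) by exact: nbhsx_ballx.
  by apply: filterS => z; rewrite -ball_normE/= distrC.
have : \forall C \near +oo, closure Omega `*` closure Omega `<=` Q C.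
  apply: (near_covering_nbhs _ cK) => -[p q] [/= cp cq].
  have [d1 [C1 [d10 C10 H1]]] := loc p cp.
  have [epq|npq] := eqVneq p q.
    exists ([set x | `|x - p| < d1] `*` [set y | `|y - p| < d1]), [set C | C1 <= C]; split.
    - by exists ([set x | `|x - p| < d1], [set y | `|y - p| < d1]) => //;
        split; [|rewrite -epq]; exact: nballx.
    - by apply: nbhs_pinfty_ge; exact: num_real.
    - move=> [x y] C [/= xp yp] C1C.
      have [[cx cy]|ncxy] := pselect (closure Omega x /\ closure Omega y); last by right.
      left; apply: le_trans (H1 x y cx cy xp yp) _.
      by rewrite lee_fin ler_wpM2r.
  have [d2 [C2 [d20 C20 H2]]] := loc q cq.
  have [c pqc] := finite_bound lip M0 tri seg p q cp cq.
  (* Moving [p] and [q] by less than a quarter of their distance keeps [|y - x|] at least [e], so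
     [N / e] is a sufficient slope. *)
  pose e := `|q - p| / 4.
  have e0 : 0 < e by rewrite divr_gt0// normr_gt0 subr_eq0 eq_sym.
  have qpe : `|q - p| = e * 4 by rewrite /e divfK.
  pose N := `|C1 * e + c + C2 * e|.
  exists ([set x | `|x - p| < Num.min d1 e] `*` [set y | `|y - q| < Num.min d2 e]),
    [set C | N / e <= C]; split.
  - exists ([set x | `|x - p| < Num.min d1 e], [set y | `|y - q| < Num.min d2 e]) => //.
    by split; apply: nballx; rewrite lt_min ?d10 ?d20.
  - by apply: nbhs_pinfty_ge; exact: num_real.
  - move=> [x y] C [/=]; rewrite !lt_min => /andP[xd1 xe] /andP[yd2 ye] NC.
    have [[cx cy]|ncxy] := pselect (closure Omega x /\ closure Omega y); last by right.
    left => /=.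
    have pp : `|p - p| < d1 by rewrite subrr normr0.
    have qq : `|q - q| < d2 by rewrite subrr normr0.
    have := tri _ _ _ _ _ (tri _ _ _ _ _ (H1 x p cx cp xd1 pp) pqc) (H2 q y cq cy qq yd2).
    move=> /le_trans; apply; rewrite lee_fin.
    have yx : e <= `|y - x|.
      have : `|q - p| <= `|q - y| + `|y - x| + `|x - p|.
        have -> : q - p = (q - y) + (y - x) + (x - p)
          by apply/rowP => i; rewrite !mxE; ring.
        apply: le_trans (ler_normD _ _) _; rewrite lerD2r; exact: ler_normD.
      by rewrite qpe (distrC q); lra.
    have N0 : 0 <= N by exact: normr_ge0.
    have h1 : C1 * `|p - x| <= C1 * e by rewrite distrC ler_wpM2l// ltW.
    have h2 : C2 * `|y - q| <= C2 * e by rewrite ler_wpM2l// ltW.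
    have h3 : C1 * e + c + C2 * e <= N by exact: ler_norm.
    have NCe : N <= C * e by rewrite -ler_pdivrMr.
    have C0 : 0 <= C by apply: le_trans NC; rewrite divr_ge0// ltW.
    have : C * e <= C * `|y - x| by rewrite ler_wpM2l.
    lra.
(* The property holds strictly beyond [C]; this choice is beyond it and nonnegative. *)
move=> [C [_ HC]]; exists (Num.max C 0 + 1); split.
  by rewrite addr_ge0// le_max lexx orbT.
move=> x y cx cy.
have : C < Num.max C 0 + 1 by rewrite ltr_pwDr// le_max lexx.
by move=> /HC/(_ (x, y))/(_ (conj cx cy))[//|[]].
Qed.

(** * Bounds drawn from the Tonelli and critical value hypotheses *)

Lemma enorm_le [R : realType] [n : nat] (v : 'rV[R]_n) :
  enorm v <= Num.sqrt (n%:R * `|v| ^+ 2).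
Proof.
rewrite /enorm ler_wsqrtr//.
apply: (@le_trans _ _ (\sum_(i < n) `|v| ^+ 2)).
  apply: ler_sum => i _; rewrite -(real_normK (num_real (v 0 i))).
  by rewrite lerXn2r ?nnegrE// rV_norm_ge.
by rewrite sumr_const card_ord mulr_natl.
Qed.

Lemma tonelli_continuous [R : realType] [n : nat] [L : 'rV[R]_n -> 'rV[R]_n -> R] :
  tonelli L -> continuous (fun p : 'rV[R]_n * 'rV[R]_n => L p.1 p.2).
Proof. by move=> [[[dL _] _] _ _] p; exact: differentiable_continuous. Qed.

Lemma tonelli_bounded [R : realType] [n : nat] [L : 'rV[R]_n -> 'rV[R]_n -> R] :
  tonelli L -> exists M, 0 < M /\ forall x v, `|v| <= 1 -> L x v <= M.
Proof.
move=> [_ _ [theta1 [theta2 [c0 [_ [th0 thM _] _ LM]]]]].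
pose r : R := Num.sqrt n%:R.
(* Sup norm at most 1 means Euclidean norm at most [r], and [theta2] is nondecreasing; adding 1
   makes the bound positive. *)
exists (theta2 r + 1); split; first by rewrite ltr_wpDl// th0// sqrtr_ge0.
move=> x v v1; have /andP[_ Lth] := LM x v.
apply: le_trans Lth _; apply: ler_wpDr => //; apply: thM; first exact: sqrtr_ge0.
apply: le_trans (enorm_le _) _; rewrite ler_wsqrtr// -[leRHS]mulr1.
by rewrite ler_wpM2l// exprn_ile1.
Qed.

Lemma potential_triangular [R : realType] [n : nat] (L : 'rV[R]_n -> 'rV[R]_n -> R)
    (Omega : set 'rV[R]_n) :
  continuous (fun p : 'rV[R]_n * 'rV[R]_n => L p.1 p.2) ->
  triangular (potential L Omega).
Proof.
move=> cL x y z a b xy yz; apply/lee_addgt0Pr => e e0.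
have e2 : 0 < e / 2 by exact: divr_gt0.
have -> : ((a + b)%:E + e%:E = (a + e / 2)%:E + (b + e / 2)%:E)%E.
  by rewrite -!EFinD; congr EFin; field.
apply: ltW; apply: (potential_concat y) => //.
  by apply: le_lt_trans xy _; rewrite lte_fin ltrDl.
by apply: le_lt_trans yz _; rewrite lte_fin ltrDl.
Qed.

Lemma potential_loop_ge0 (R : realType) (n : nat) (L : 'rV[R]_n -> 'rV[R]_n -> R)
    (Omega : set 'rV[R]_n) (x : 'rV[R]_n) :
  (critical_value L Omega <= 0)%E -> closure Omega x -> (0 <= potential L Omega x x)%E.
Proof.
rewrite /critical_value oppe_le0 => c0 cx; apply: le_ereal_inf_tmp => _ [t /= t0 <-].
rewrite -(@pmule_rge0 _ (t^-1)%:E) ?lte_fin ?invr_gt0//.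
by apply: le_trans c0 _; apply: ereal_inf_lbound; exists t, x.
Qed.
Theorem proposition3p1 (R : realType) (n : nat) (Omega : set 'rV[R]_n.+1)
    (L : 'rV[R]_n.+1 -> 'rV[R]_n.+1 -> R) (g : 'rV[R]_n.+1 -> R)
    (u := boundary_solution L Omega g) :
  lipschitz_domain Omega -> bounded_set Omega ->
  tonelli L ->
  (forall x y, boundary Omega x -> boundary Omega y ->
     ((g x - g y)%:E <= potential L Omega y x)%E) ->
  (critical_value L Omega <= 0)%E ->
  [/\ forall x, closure Omega x -> u x \is a fin_num,
      forall x x', closure Omega x -> closure Omega x' ->
        (u x' - u x <= potential L Omega x x')%E,
      [lipschitz fine (u x) | x in closure Omega] &
      forall x, boundary Omega x -> u x = (g x)%:E].

Proof.
move=> lip bO ton gP c0; have [[oO cO O0] _] := lip.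
have cL := tonelli_continuous ton.
have [M [M0 LM]] := tonelli_bounded ton.
have tri := potential_triangular _ Omega cL.
have seg : segment_bounded Omega (potential L Omega) M.
  by move=> x y xy; exact: potential_segment.
have [C [C0 PC]] := global_bound lip bO M0 tri seg.
set P := potential L Omega in gP tri seg PC *.
have loop x : closure Omega x -> (0 <= P x x)%E by exact: potential_loop_ge0.
have Pfin x y : closure Omega x -> closure Omega y -> P x y \is a fin_num.
  (* If [P x y] were minus infinity, going to [y] at cost below [- c] and returning at cost at most
     [c] would be a loop of negative cost. *)
  move=> cx cy; rewrite fin_numE; apply/andP; split; apply/eqP => Pxy.
    have yx := PC y x cy cx; set c := C * _ in yx.
    have xyN : (P x y <= (- (c + 1))%:E)%E by rewrite Pxy leNye.
    have := le_trans (loop x cx) (tri _ _ _ _ _ xyN yx).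
    by rewrite lee_fin; lra.
  by have := PC x y cx cy; rewrite Pxy leye_eq.
pose p x y := fine (P x y).
have PE x y : closure Omega x -> closure Omega y -> P x y = (p x y)%:E.
  by move=> cx cy; rewrite fineK// Pfin.
have ptri x y z : closure Omega x -> closure Omega y -> closure Omega z ->
    p x z <= p x y + p y z.
  move=> cx cy cz; rewrite -lee_fin -PE//; apply: tri; first by rewrite PE.
  by rewrite PE.
have pC x y : closure Omega x -> closure Omega y -> p x y <= C * `|y - x|.
  by move=> cx cy; rewrite -lee_fin -PE// PC.
have bcl y : boundary Omega y -> closure Omega y by case.
have gp x y : boundary Omega x -> boundary Omega y -> g x - g y <= p y x.
  by move=> bx by_; rewrite -lee_fin -PE ?gP//; exact: bcl.
have [y0 by0] := boundary_nonempty oO O0 bO.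
have u_le x y : closure Omega x -> boundary Omega y -> (u x <= (g y + p y x)%:E)%E.
  move=> cx by_; apply: ereal_inf_lbound; exists y => //.
  by rewrite -/P PE//; exact: bcl.
have u_ge x r : closure Omega x ->
    (forall y, boundary Omega y -> r <= g y + p y x) -> (r%:E <= u x)%E.
  move=> cx H; apply: le_ereal_inf_tmp => _ [y by_ <-].
  by rewrite -/P PE ?lee_fin//; [exact: H|exact: bcl].
have ufin x : closure Omega x -> u x \is a fin_num.
  move=> cx; rewrite fin_numE; apply/andP; split; apply/eqP => ux.
    have : ((g y0 - p x y0)%:E <= u x)%E.
      (* Compatibility of [g] at [y0] and [y], with the triangle inequality through [x], bounds
         [g y + p y x] below independently of [y]. *)
      apply: u_ge => // y by_.
      have := gp _ _ by0 by_; have := ptri y x y0 (bcl _ by_) cx (bcl _ by0); lra.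
    by rewrite ux leeNy_eq.
  by have := u_le x y0 cx by0; rewrite ux leye_eq.
pose U x := fine (u x).
have uE x : closure Omega x -> u x = (U x)%:E by move=> cx; rewrite fineK// ufin.
have dom x x' : closure Omega x -> closure Omega x' -> U x' - U x <= p x x'.
  move=> cx cx'.
  (* Any competitor [y] for [u x] also competes for [u x'], at extra cost at most [p x x']. *)
  have : ((U x' - p x x')%:E <= u x)%E.
    apply: u_ge => // y by_; have := u_le x' y cx' by_; rewrite uE// lee_fin.
    have := ptri y x x' (bcl _ by_) cx cx'; lra.
  by rewrite uE// lee_fin; lra.
have p_refl x : closure Omega x -> p x x <= 0.
  by move=> cx; have := pC x x cx cx; rewrite subrr normr0 mulr0.
split=> //.
- by move=> x x' cx cx'; rewrite !uE// -EFinB PE// lee_fin; exact: dom.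
- exists C; split; first exact: num_real.
  move=> K CK [x x'] [/= cx cx'].
  have CKx : C * `|x - x'| <= K * `|x - x'| by rewrite ler_wpM2r// ltW.
  apply: le_trans CKx; rewrite ler_norml.
  have := dom _ _ cx cx'; have := dom _ _ cx' cx.
  have := pC _ _ cx cx'; have := pC _ _ cx' cx; rewrite (distrC x').
  by rewrite /U => *; apply/andP; split; lra.
- move=> x bx; have cx := bcl _ bx; rewrite uE//; congr EFin; apply/eqP.
  (* The upper bound takes [y = x] in the infimum, where [p x x <= 0]; the lower bound is the
     compatibility of [g]. *)
  rewrite eq_le -!lee_fin -uE//; apply/andP; split.
    apply: le_trans (u_le x x cx bx) _; rewrite lee_fin.
    by have := p_refl x cx; lra.
  by apply: u_ge => // y by_; have := gp _ _ bx by_; lra.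
Qed.
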